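(* Let $\lambda\ge 2$ be a fixed integer, let $\varepsilon>0$ be fixed, and let $(\nu_n)_{n\ge 1}$ be a fixed real sequence with $\lim_{n\to\infty}\nu_n=0$. Let $(s_n)_{n\ge 1}$ be a strictly increasing sequence of positive integers (which may depend on $X$) satisfying $s_n\le n^{15/14+\nu_n}$ for all $n$. For $X$ large, let $T=[X(\log X)^{2+\varepsilon}]$. Then there is a constant $C>0$, depending only on $\lambda$, $\varepsilon$ and the sequence $(\nu_n)$, such that the inequality $$ \max_{(a,p)=1}\Big|\sum_{n\le T}e^{2\pi i\frac{a\lambda^{s_n}}{p}}\Big|\le C\, T(\log T)^{-\varepsilon/5} $$ holds for all primes $p\le X$ except at most $o(\pi(X))$ of them, as $X\to\infty$.
   Context: $[x]$ denotes the integer part of $x$; $\pi(X)$ denotes the number of primes not exceeding $X$; $(a,p)$ denotes the greatest common divisor, and the maximum is over integers $a$ coprime to $p$. The sum over $n\le T$ is over positive integers $n\le T$. The sequence $(\nu_n)$ does not depend on $X$ (or $T$). *)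

(* Defs.v *)
(* MathComp / MathComp-Analysis *)
From mathcomp Require Import all_boot all_order all_algebra.
From mathcomp Require Import all_classical all_reals all_analysis.
From mathcomp Require Import complex.

Set Implicit Arguments.
Unset Strict Implicit.
Unset Printing Implicit Defensive.

Import Order.TTheory GRing.Theory Num.Theory.
Import numFieldNormedType.Exports.

Local Open Scope ring_scope.
Local Open Scope classical_set_scope.
Local Open Scope complex_scope.

(* pinfty_nbhs has no canonical filter_on structure, which the Landau notations
   require. *)
Definition pinfty_filter (R : realType) : filter_on R :=
  FilterType (pinfty_nbhs R) _.

(* e^{2 pi i t} for real t *)
Definition expi2pi (R : realType) (t : R) : R[i] :=
  cos (2 * pi * t) +i* sin (2 * pi * t).

Definition expsum (R : realType) (lam : nat) (s : nat -> nat) (T p : nat)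
    (a : int) : R[i] :=
  \sum_(1 <= n < T.+1) expi2pi (a%:~R * lam%:R ^+ s n / p%:R : R).

(* The library norm on R[i] is R[i]-valued (with zero imaginary part), hence the
   real part.  For p > 0 the sum depends only on a mod p, so that the set below
   is finite and nonempty and its supremum is its maximum. *)
Definition max_expsum (R : realType) (lam : nat) (s : nat -> nat) (T p : nat) :
    R :=
  sup [set complex.Re `|expsum R lam s T p a| | a in [set a : int | coprimez a p%:Z]].

(* The number of primes p <= X satisfying P. *)
Definition count_primes (R : realType) (X : R) (P : pred nat) : nat :=
  #|[set p : 'I_(Num.truncn X).+1 | prime p && P p]|.

Definition prime_pi (R : realType) (X : R) : nat := count_primes X xpredT.

Definition sum_length (R : realType) (eps X : R) : nat :=
  Num.truncn (X * ln X `^ (2 + eps)).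

(* A sequence indexed by n >= 1; the value s 0 is irrelevant. *)
Definition admissible (R : realType) (nu : nat -> R) (s : nat -> nat) : Prop :=
  [/\ forall n, (1 <= n)%N -> (1 <= s n)%N,
      forall m n, (1 <= m)%N -> (m < n)%N -> (s m < s n)%N
    & forall n, (1 <= n)%N -> (s n)%:R <= n%:R `^ (15 / 14 + nu n)].

(* The number of primes p <= X at which the bound fails. *)
Definition exceptional_count (R : realType) (lam : nat) (eps C : R)
    (s : nat -> nat) (X : R) : nat :=
  let T := sum_length eps X in
  count_primes X
    (fun p => ~~ (max_expsum R lam s T p <= C * T%:R * ln T%:R `^ (- (eps / 5)))).

(* Main.v *)
Require Import Defs.
From mathcomp Require Import all_boot all_order all_algebra.
From mathcomp Require Import cyclic.
From mathcomp Require Import all_classical all_reals all_analysis.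
From mathcomp Require Import complex.
From mathcomp Require Import ring lra zify.

Set Implicit Arguments.
Unset Strict Implicit.
Unset Printing Implicit Defensive.

Import Order.TTheory GRing.Theory Num.Theory.
Import numFieldNormedType.Exports.
Import Normc.

Local Open Scope ring_scope.
Local Open Scope classical_set_scope.

(** Write sigma_p(a) for the exponential sum, t_p for the order of lam modulo p,
    and let eta be a small positive constant. With the constant C = 1, the
    number of exceptional primes is at most X ^ (1 - eta / 2) for large X
    ([exceptional_count_le]).

    Let G be a set of exceptional primes, with a_p a frequency at which the
    bound fails for p. Aligning the sums by unimodular factors th_p and
    exchanging the order of summation gives
      sum_(p in G) |sigma_p(a_p)| <= sum_(n <= T) |A(s_n)|,
      A(m) = sum_(p in G) th_p e(a_p lam ^ m / p).
    By Cauchy's inequality the square of this is at most T times the sum of the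
    |A(s_n)|^2, and that sum may be extended to all m <= S, where S bounds the
    s_n. This is wasteful only by the density of the sequence, about X ^ (1/14).
    Up to a harmless translation, m can be written as j + k in about S ways,
    with j and k in an interval of length about S. Opening the square leaves,
    for each pair (p, p'), a sum over (j, k) of a t_p-periodic function of j + k
    times a t_p'-periodic one. Fourier expansion of the two factors turns it
    into squares of sums of additive characters, whose total is computed exactly
    ([bilinear_le]); after division by S the pair contributes a constant times
      M_p M_p' (1 + S gcd(t_p, t_p') / (t_p t_p')),
    where M_p bounds the Fourier coefficients
      sum_(x < t_p) e(- b x / t_p) e(a lam ^ x / p),
    uniformly in b and in a coprime to p. This is [exp_sums_large_sieve].

    There are two bounds for M_p. The second moment over a gives
    M_p <= p ^ (1/2), so that the first term contributes O(X |G|^2); this is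
    absorbed by the left-hand side because T / X exceeds every constant times
    (ln T) ^ (2 eps / 5). The fourth moment, applied to blocks of K ~ X ^ (1/3)
    consecutive exponents, bounds M_p in terms of the additive energy modulo p
    of the lam ^ l with l < K. Since a nonzero integer
    lam ^ l1 + lam ^ l2 - lam ^ l3 - lam ^ l4 has O(K) prime factors, that
    energy is nearly minimal for most p ([sum_energy_le]). As moreover
    t_p >= X ^ (1/2 - eta) for most p ([card_small_order_le]), this gives
    M_p <= t_p X ^ (- 1/24 + eta / 2), and the second term contributes at most
    S X ^ (- 1/12 + eta) times the sum of the gcd(t_p, t_p'). These divide
    gcd(p - 1, p' - 1), whose average is O(ln X). So |G|^2 X is at most
    X ^ (15/14 - 1/12 + 2) up to small powers of X, and the theorem rests on
    1/14 < 1/12. Chebyshev's lower bound for the number of primes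
    ([prime_pi_ge]) concludes. *)

(** * Additive characters *)

(** The complex numbers bundled as a structure: every operation on [CC R] is
    then found along the same inheritance path, so that rewriting does not stall
    on convertible but different instances on [complex R]. *)
Definition CC (R : realType) : numClosedFieldType := complex R.

(** The norm of [complex R] takes its values in [complex R] itself; this
    real-valued version keeps inequalities in a totally ordered field. *)
Definition cabs (R : realType) (z : CC R) : R := normc z.

Section AdditiveCharacters.
Variable R : realType.
Local Notation C := (CC R).
Implicit Types (u v : int) (q : nat) (z : C).

Definition toC (x : R) : C := real_complex R x.

Lemma cabsE z : `|z| = toC (cabs z).
Proof. by []. Qed.

Lemma toC_sum (I : Type) (r : seq I) (P : pred I) (F : I -> R) :
  toC (\sum_(i <- r | P i) F i) = \sum_(i <- r | P i) toC (F i).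
Proof. exact: (rmorph_sum (real_complex R)). Qed.

Lemma toC_nat n : toC n%:R = n%:R.
Proof. exact: (rmorph_nat (real_complex R)). Qed.

Lemma toCX x n : toC (x ^+ n) = toC x ^+ n.
Proof. exact: (rmorphXn (real_complex R)). Qed.

Lemma ler_toC x y : (toC x <= toC y) = (x <= y).
Proof. exact: lecR. Qed.

Lemma toC_inj : injective toC.
Proof. exact: complexI. Qed.

Lemma cabs_ge0 z : 0 <= cabs z.
Proof. by rewrite -ler_toC -cabsE (toC_nat 0) normr_ge0. Qed.

Lemma cabs_sum (I : Type) (r : seq I) (P : pred I) (F : I -> C) :
  cabs (\sum_(i <- r | P i) F i) <= \sum_(i <- r | P i) cabs (F i).
Proof. by rewrite -ler_toC -cabsE toC_sum ler_norm_sum. Qed.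

Lemma cabsM (x y : C) : cabs (x * y) = cabs x * cabs y.
Proof. exact: normcM. Qed.

Lemma cabs_conj z : cabs z^* = cabs z.
Proof. by apply: toC_inj; rewrite -!cabsE norm_conjC. Qed.

Lemma cabsX z n : cabs (z ^+ n) = cabs z ^+ n.
Proof. by apply: toC_inj; rewrite toCX -!cabsE normrX. Qed.

Lemma cabs_nat n : cabs (n%:R : C) = n%:R.
Proof. by apply: toC_inj; rewrite -cabsE normr_nat toC_nat. Qed.

Lemma cabs_toC x : 0 <= x -> cabs (toC x) = x.
Proof. by move=> x0; rewrite /cabs /= expr0n/= addr0 sqrtr_sqr ger0_norm. Qed.

Lemma cabs_sqr z : toC (cabs z ^+ 2) = z * z^*.
Proof. by rewrite toCX -cabsE normCK. Qed.

Lemma conj_sum (I : Type) (r : seq I) (P : pred I) (F : I -> C) :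
  (\sum_(i <- r | P i) F i)^* = \sum_(i <- r | P i) (F i)^*.
Proof. exact: rmorph_sum. Qed.

Lemma conjM (x y : C) : (x * y)^* = x^* * y^*.
Proof. exact: rmorphM. Qed.

(** The additive character e(u / q) of the integers modulo q. *)
Definition ez q u : C := expi2pi (u%:~R / q%:R).

Lemma expi2piD (x y : R) : expi2pi (x + y) = expi2pi x * expi2pi y :> C.
Proof.
rewrite /expi2pi mulrDr cosD sinD.
by apply/eqP; rewrite eq_complex/= addrC eqxx/= [X in _ == X]addrC eqxx.
Qed.

Lemma expi2piN (x : R) : expi2pi (- x) = (expi2pi x : C)^*.
Proof. by rewrite /expi2pi mulrN cosN sinN. Qed.

Lemma cabs_expi2pi (x : R) : cabs (expi2pi x) = 1.
Proof. by rewrite /expi2pi /= cos2Dsin2 sqrtr1. Qed.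

Lemma expi2pi0 : expi2pi 0 = 1 :> C.
Proof. by rewrite /expi2pi mulr0 cos0 sin0. Qed.

Lemma expi2pi1 : expi2pi 1 = 1 :> C.
Proof. by rewrite /expi2pi mulr1 mulr_natl cos2pi sin2pi. Qed.

Lemma expi2piMn (x : R) n : expi2pi (x *+ n) = (expi2pi x : C) ^+ n.
Proof.
elim: n => [|n IHn]; first by rewrite mulr0n expi2pi0 expr0.
by rewrite mulrS expi2piD IHn exprS.
Qed.

(** The double angle formula gives real part [1 - 2 sin(pi x)^2]. *)
Lemma expi2pi_neq1 (x : R) : 0 < x < 1 -> expi2pi x != 1 :> C.
Proof.
move=> /andP[x0 x1]; apply/negP => /eqP[+ _].
rewrite -mulrA mulr_natl cos_mulr2n => h.
have s0 : 0 < sin (pi * x).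
  by rewrite sin_gt0_pi// mulr_gt0 ?pi_gt0//= gtr_pMr// pi_gt0.
have := cos2Dsin2 (pi * x); nra.
Qed.

Lemma ezD q u v : ez q (u + v) = ez q u * ez q v.
Proof. by rewrite /ez rmorphD mulrDl expi2piD. Qed.

Lemma ezN q u : ez q (- u) = (ez q u)^*.
Proof. by rewrite /ez rmorphN mulNr expi2piN. Qed.

Lemma cabs_ez q u : cabs (ez q u) = 1.
Proof. exact: cabs_expi2pi. Qed.

Lemma ezMn q u n : ez q (u *+ n) = ez q u ^+ n.
Proof. by rewrite /ez rmorphMn mulrnAl expi2piMn. Qed.

Lemma ez_dvd q u : (0 < q)%N -> (q %| u)%Z -> ez q u = 1.
Proof.
move=> q0 /dvdzP[k ->].
have qq : ez q q = 1 by rewrite /ez divff ?expi2pi1// pnatr_eq0 -lt0n.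
have hn n : ez q (n%:Z * q) = 1 by rewrite -[n%:Z]natz mulr_natl ezMn qq expr1n.
case: (intP k) => [|n|n]; rewrite ?hn//.
by rewrite mulNr ezN hn conjC1.
Qed.

Lemma ez_eq q u v : (0 < q)%N -> (u == v %[mod q])%Z -> ez q u = ez q v.
Proof.
move=> q0; rewrite eqz_mod_dvd => h.
by rewrite -[u](subrK v) ezD (ez_dvd q0 h) mul1r.
Qed.

Lemma ez_neq1 q u : (0 < q)%N -> ~~ (q %| u)%Z -> ez q u != 1.
Proof.
move=> q0 qu.
have q0z : (q%:Z != 0) by rewrite eqz_nat -lt0n.
rewrite (@ez_eq _ _ (u %% q)%Z)//; last by rewrite modz_mod.
have r0 : (0 < (u %% q)%Z)%R.
  rewrite lt_neqAle modz_ge0// andbT eq_sym.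
  by apply: contra qu => /eqP/dvdz_mod0P.
have r1 : ((u %% q)%Z < q)%R by rewrite (ltz_mod u q0z).
rewrite /ez expi2pi_neq1// divr_gt0 ?ltr0z// ?ltr0n//=.
by rewrite ltr_pdivrMr ?ltr0n// mul1r -[q%:R]/(q%:~R) ltr_int.
Qed.

(** Orthogonality: off the trivial case this is a geometric sum whose ratio is a
    root of unity different from 1. *)
Lemma sum_ez q u : (0 < q)%N ->
  \sum_(h < q) ez q (u *+ h) = if (q %| u)%Z then q%:R else 0.
Proof.
move=> q0; case: ifPn => qu.
  under eq_bigr do rewrite ezMn ez_dvd// expr1n.
  by rewrite sumr_const card_ord.
under eq_bigr do rewrite ezMn.
have := subrX1 (ez q u) q.
rewrite -ezMn ez_dvd//; last by rewrite -mulr_natr natz dvdz_mull.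
rewrite subrr => /esym/eqP; rewrite mulf_eq0 subr_eq0 (negbTE (ez_neq1 q0 qu))/=.
by move/eqP.
Qed.

End AdditiveCharacters.

(** * Moments and Fourier coefficients of exponential sequences *)

Lemma sqr_sum_le (R : realFieldType) (I : finType) (P : pred I) (F : I -> R) :
  (\sum_(i | P i) F i) ^+ 2 <= #|P|%:R * \sum_(i | P i) F i ^+ 2.
Proof.
rewrite expr2 mulr_suml.
under eq_bigr do rewrite mulr_sumr.
have : \sum_(i | P i) \sum_(j | P j) F i * F j <=
       \sum_(i | P i) \sum_(j | P j) (F i ^+ 2 + F j ^+ 2) / 2.
  apply: ler_sum => i _; apply: ler_sum => j _.
  have := sqr_ge0 (F i - F j); lra.
move=> /le_trans; apply.
under eq_bigr do rewrite -mulr_suml big_split/= sumr_const.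
rewrite -mulr_suml big_split/= sumr_const !sumrMnl.
by rewrite -mulr2n -[X in X / 2]mulr_natr mulfK ?pnatr_eq0//= mulr_natl.
Qed.

Lemma sum_inj_le (R : numDomainType) (I J : finType) (P : pred I) (h : I -> J) (F : J -> R) :
  {in P &, injective h} -> (forall j, 0 <= F j) -> \sum_(i | P i) F (h i) <= \sum_j F j.
Proof.
move=> hI F0.
rewrite -(big_imset F hI)/= [leRHS](bigID [in h @: P])/=.
by rewrite lerDl sumr_ge0.
Qed.

Section Moments.
Variable R : realType.
Local Notation C := (CC R).

(** Expanding the square and using orthogonality in h counts the solutions of a
    congruence. With I a set of pairs this is also the fourth moment. *)
Lemma second_moment_le (p : nat) (I : finType) (c : I -> C) (v : I -> int) :
  (0 < p)%N -> (forall i, cabs (c i) = 1) ->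
  \sum_(h < p) cabs (\sum_i c i * ez R p (v i *+ h)) ^+ 2
  <= p%:R * #|[pred ij : I * I | (p %| v ij.1 - v ij.2)%Z]|%:R :> R.
Proof.
move=> p0 c1.
set L := leLHS.
have -> : L = cabs (toC L).
  by rewrite cabs_toC// sumr_ge0// => *; rewrite sqr_ge0.
have -> : (toC L) = \sum_(ij : I * I) c ij.1 * (c ij.2)^* *
                 (if (p %| v ij.1 - v ij.2)%Z then p%:R else 0).
  rewrite toC_sum.
  under [RHS]eq_bigr do rewrite -sum_ez// mulr_sumr.
  rewrite exchange_big; apply: eq_bigr => h _.
  rewrite cabs_sqr conj_sum big_distrlr pair_bigA; apply: eq_bigr => -[i j] _ /=.
  rewrite mulrnBl ezD ezN conjM; ring.
rewrite (le_trans (cabs_sum _ _ _))// -sum1_card natr_sum mulr_sumr.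
rewrite [leRHS]big_mkcond/=; apply: ler_sum => -[i j] _ /=.
rewrite !cabsM cabs_conj !c1 !mul1r.
by rewrite unfold_in /=; case: ifP => _; rewrite ?mulr1 ?cabs_nat ?(cabs_nat R 0).
Qed.

Definition dft (f : nat -> C) (t : nat) (b : nat) : C :=
  \sum_(x < t) ez R t (- (b * x)%N%:Z) * f x.

Lemma sum_periodic (t l : nat) (g : nat -> C) : (forall x, g (x + t)%N = g x) ->
  \sum_(x < t) g (x + l)%N = \sum_(x < t) g x.
Proof.
move=> gP; elim: l => [|l IHl]; first by under eq_bigr do rewrite addn0.
rewrite -IHl; case: t gP {IHl} => [|t] gP; first by rewrite !big_ord0.
rewrite big_ord_recr big_ord_recl/= addrC; congr (_ + _).
  by rewrite add0n -(gP l); congr g; lia.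
by apply: eq_bigr => i _; congr g; rewrite /bump/=; lia.
Qed.

Lemma ez_period (t b x y : nat) : (0 < t)%N -> x = y %[mod t] ->
  ez R t (- (b * x)%N%:Z) = ez R t (- (b * y)%N%:Z).
Proof.
move=> t0 xy; rewrite !ezN; congr (_^*); apply: ez_eq => //.
by rewrite !modz_nat eqz_nat -modnMmr xy modnMmr.
Qed.

Lemma fourier_inversion (f : nat -> C) (t m : nat) : (0 < t)%N ->
  (forall x, f (x %% t)%N = f x) ->
  t%:R * f m = \sum_(b < t) dft f t b * ez R t (b * m)%N%:Z.
Proof.
move=> t0 fP.
have key (x : 'I_t) : \sum_(b < t) ez R t (- (b * x)%N%:Z) * ez R t (b * m)%N%:Z =
    if (x == m %% t :> nat)%N then t%:R else 0.
  have -> : (x == m %% t :> nat)%N = (t %| m%:Z - x%:Z)%Z.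
    by rewrite -eqz_mod_dvd !modz_nat eqz_nat (modn_small (ltn_ord x)) eq_sym.
  rewrite -sum_ez//; apply: eq_bigr => b _; rewrite -ezD; congr ez.
  by rewrite !PoszM -mulr_natr natz; ring.
transitivity (\sum_(x < t) f x * (if (x == m %% t :> nat)%N then t%:R else 0)).
  rewrite (bigD1 (Ordinal (ltn_pmod m t0)))//= eqxx fP mulrC big1 ?addr0// => x xm.
  by rewrite ifN ?mulr0.
under eq_bigr do rewrite -key mulr_sumr.
rewrite exchange_big/=; apply: eq_bigr => b _.
rewrite /dft mulr_suml; apply: eq_bigr => x _; ring.
Qed.

(** Shifting x by l < K does not change the sum over a full period, so the
    coefficient is an average of short sums of length K. *)
Lemma interval_dft (f : nat -> C) (t b K : nat) : (0 < t)%N ->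
  (forall x, f (x + t)%N = f x) ->
  K%:R * cabs (dft f t b) <=
  \sum_(x < t) cabs (\sum_(l < K) ez R t (- (b * l)%N%:Z) * f (x + l)%N).
Proof.
move=> t0 fP; rewrite -(cabs_nat R) -cabsM.
have -> : K%:R * dft f t b = \sum_(x < t) ez R t (- (b * x)%N%:Z) *
    \sum_(l < K) ez R t (- (b * l)%N%:Z) * f (x + l)%N.
  transitivity (\sum_(l < K) dft f t b).
    by rewrite sumr_const card_ord mulr_natl.
  under [RHS]eq_bigr do rewrite mulr_sumr.
  rewrite [RHS]exchange_big/=; apply: eq_bigr => l _.
  rewrite /dft -(@sum_periodic _ l (fun x => ez R t (- (b * x)%N%:Z) * f x)); last first.
    by move=> x; rewrite fP; congr (_ * _); apply: ez_period; rewrite ?modnDr.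
  apply: eq_bigr => x _; rewrite mulrA -ezD; congr (ez _ _ _ * _).
  by rewrite mulnDr PoszD opprD.
rewrite (le_trans (cabs_sum _ _ _))//; apply: ler_sum => x _.
by rewrite cabsM cabs_ez mul1r.
Qed.

(** For lam coprime to p this says that t is the multiplicative order of lam
    modulo p, in the only form in which the order is used. *)
Definition is_order (lam p t : nat) :=
  (0 < t)%N /\ forall j k, (lam ^ j == lam ^ k %[mod p])%N = (j == k %[mod t])%N.

Definition fexp (p : nat) (a : int) (lam m : nat) : C := ez R p (a * (lam ^ m)%N%:Z).

Lemma fexp_periodic p a lam t : (0 < p)%N -> is_order lam p t ->
  forall x y, x = y %[mod t] -> fexp p a lam x = fexp p a lam y.
Proof.
move=> p0 [_ ht] x y xy; apply: ez_eq => //.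
rewrite -modzMmr -[eqbRHS]modzMmr !modz_nat.
by have /eqP -> : (lam ^ x == lam ^ y %[mod p])%N by rewrite ht xy.
Qed.

Definition energy (lam p K : nat) :=
  #|[pred q : ('I_K * 'I_K) * ('I_K * 'I_K) |
     lam ^ q.1.1 + lam ^ q.1.2 == lam ^ q.2.1 + lam ^ q.2.2 %[mod p]]|%N.

(** The residues a lam ^ x with x < t are distinct, so a sum over the orbit is
    dominated by the complete sum. This is where positivity replaces any
    knowledge of the distribution of the orbit. *)
Lemma orbit_sum_le (p t lam : nat) (a : int) (F : nat -> R) :
  (0 < p)%N -> coprimez a p -> is_order lam p t -> (forall n, 0 <= F n) ->
  \sum_(x < t) F `|(a * (lam ^ x)%N%:Z %% p)%Z|%N <= \sum_(h < p) F h.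
Proof.
move=> p0 ap [t0 ht] F0.
have hx (x : 'I_t) : (`|(a * (lam ^ x)%N%:Z %% p)%Z| < p)%N.
  have pz : p%:Z != 0 by rewrite eqz_nat -lt0n.
  by rewrite -ltz_nat gez0_abs ?modz_ge0// ltz_mod.
apply: (@sum_inj_le _ _ _ predT (fun x : 'I_t => Ordinal (hx x)) (fun h : 'I_p => F h)) => // x y _ _.
move=> /(congr1 val)/= xy; apply: val_inj => /=.
have pz : p%:Z != 0 by rewrite eqz_nat -lt0n.
have {}xy : (a * (lam ^ x)%N%:Z == a * (lam ^ y)%N%:Z %[mod p])%Z.
  by rewrite -[eqbLHS]gez0_abs ?modz_ge0// xy gez0_abs ?modz_ge0.
move: xy; rewrite eqz_mod_dvd -mulrBr Gauss_dvdzr; last by rewrite coprimez_sym.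
rewrite -eqz_mod_dvd !modz_nat eqz_nat ht.
by rewrite !modn_small// => /eqP.
Qed.

Lemma fexp_orbit (p lam x l : nat) (a : int) : (0 < p)%N ->
  fexp p a lam (x + l) = ez R p ((lam ^ l)%N%:Z *+ `|(a * (lam ^ x)%N%:Z %% p)%Z|%N).
Proof.
move=> p0; apply: ez_eq => //.
have pz : p%:Z != 0 by rewrite eqz_nat -lt0n.
rewrite -mulr_natr natz gez0_abs ?modz_ge0// modzMmr.
by apply/eqP; congr modz; rewrite expnD PoszM; ring.
Qed.

Lemma dft_fexp_moment (p t lam b K k : nat) (a : int) :
  (0 < p)%N -> coprimez a p -> is_order lam p t ->
  \sum_(x < t) cabs (\sum_(l < K) ez R t (- (b * l)%N%:Z) * fexp p a lam (x + l)) ^+ k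
  <= \sum_(h < p) cabs (\sum_(l < K) ez R t (- (b * l)%N%:Z) *
                         ez R p ((lam ^ l)%N%:Z *+ h)) ^+ k.
Proof.
move=> p0 ap ht.
have := @orbit_sum_le p t lam a (fun h => cabs (\sum_(l < K) ez R t (- (b * l)%N%:Z) *
                         ez R p ((lam ^ l)%N%:Z *+ h)) ^+ k) p0 ap ht.
move=> /(_ (fun _ => exprn_ge0 _ (cabs_ge0 _))); apply: le_trans.
apply: ler_sum => x _.
by under eq_bigr do rewrite fexp_orbit//.
Qed.

(** The blocks are full periods here: their second moment has only diagonal
    solutions, since the powers of lam below the order are distinct. *)
Lemma dft_fexp_le_sqrt (p t lam b : nat) (a : int) :
  (0 < p)%N -> coprimez a p -> is_order lam p t ->
  cabs (dft (fexp p a lam) t b) ^+ 2 <= p%:R.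
Proof.
move=> p0 ap ht; have [t0 h] := ht.
have tR : 0 < t%:R ^+ 2 :> R by rewrite exprn_gt0// ltr0n.
rewrite -(ler_pM2l tR) -exprMn.
have := @interval_dft (fexp p a lam) t b t t0.
move=> /(_ (fun x => fexp_periodic a p0 ht (modnDr x t))) h1.
rewrite (@le_trans _ _ ((\sum_(x < t) cabs (\sum_(l < t) ez R t (- (b * l)%N%:Z) *
     fexp p a lam (x + l))) ^+ 2))//.
  by rewrite lerXn2r// nnegrE ?mulr_ge0 ?cabs_ge0 ?sumr_ge0// => *; rewrite cabs_ge0.
rewrite (le_trans (sqr_sum_le _ _))// card_ord expr2 -mulrA ler_wpM2l//.
rewrite (le_trans (dft_fexp_moment _ _ _ p0 ap ht))//.
rewrite (le_trans (second_moment_le _ p0 _))//; first by move=> i; rewrite cabs_ez.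
rewrite mulrC ler_wpM2r// ler_nat.
rewrite -[leqRHS]card_ord -(card_imset _ (f := fun x : 'I_t => (x, x))); last by move=> x y [].
apply/subset_leq_card/fintype.subsetP => -[x y]; rewrite inE/= -eqz_mod_dvd !modz_nat eqz_nat h.
rewrite !modn_small// => /eqP/val_inj ->.
by apply/imsetP; exists y.
Qed.

(** Hoelder's inequality over the t blocks, then the fourth moment. *)
Lemma dft_fexp_le_energy (p t lam b K : nat) (a : int) :
  (0 < p)%N -> coprimez a p -> is_order lam p t ->
  (K%:R * cabs (dft (fexp p a lam) t b)) ^+ 4 <= t%:R ^+ 3 * (p%:R * (energy lam p K)%:R).
Proof.
move=> p0 ap ht; have [t0 h] := ht.
have := @interval_dft (fexp p a lam) t b K t0.
move=> /(_ (fun x => fexp_periodic a p0 ht (modnDr x t))) h1.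
set g := fun x : 'I_t => cabs (\sum_(l < K) ez R t (- (b * l)%N%:Z) *
     fexp p a lam (x + l)).
rewrite -/(\sum_x g x) in h1.
have h2 : (\sum_x g x) ^+ 4 <= t%:R ^+ 3 * \sum_x g x ^+ 4.
  have s0 : 0 <= \sum_x g x ^+ 2 by rewrite sumr_ge0// => *; rewrite sqr_ge0.
  have := sqr_sum_le xpredT g; have := sqr_sum_le xpredT (fun x => g x ^+ 2).
  rewrite !card_ord.
  under [X in _ <= _ * X -> _]eq_bigr do rewrite -exprM.
  move=> h3 h4.
  rewrite (_ : 4%N = 2 * 2)%N// exprM.
  rewrite (@le_trans _ _ ((t%:R * \sum_x g x ^+ 2) ^+ 2))//.
    by rewrite lerXn2r// nnegrE ?sqr_ge0// mulr_ge0.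
  by rewrite exprMn [t%:R ^+ 3]exprSr -mulrA ler_wpM2l// exprn_ge0.
rewrite (@le_trans _ _ ((\sum_x g x) ^+ 4))//.
  by rewrite lerXn2r// nnegrE ?mulr_ge0 ?cabs_ge0 ?sumr_ge0// => *; rewrite cabs_ge0.
rewrite (le_trans h2)// ler_wpM2l// ?exprn_ge0//.
rewrite (le_trans (dft_fexp_moment _ _ _ p0 ap ht))//.
have h5 := @second_moment_le p ('I_K * 'I_K)%type
  (fun l => ez R t (- (b * l.1)%N%:Z) * ez R t (- (b * l.2)%N%:Z))
  (fun l => (lam ^ l.1)%N%:Z + (lam ^ l.2)%N%:Z) p0.
rewrite (le_trans _ (le_trans (h5 _) _))//.
- apply: ler_sum => x _; rewrite (_ : 4%N = 2 * 2)%N// exprM -[X in X ^+ 2 <= _]cabsX.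
  rewrite [X in cabs X ^+ 2 <= _]expr2 big_distrlr pair_bigA/=.
  by under eq_bigr => l _ do rewrite mulrACA -[X in _ * X]ezD -mulrnDl.
- by move=> l; rewrite cabsM !cabs_ez mulr1.
- rewrite ler_wpM2l// ler_nat; apply/subset_leq_card/fintype.subsetP => q; rewrite !inE.
  by rewrite -eqz_mod_dvd -!PoszD !modz_nat eqz_nat.
Qed.

End Moments.

(** * Bilinear sums of two periodic functions *)

Lemma card_congruent_le (N t : nat) (j : nat) : (0 < t)%N ->
  (#|[pred k : 'I_N | j == k %[mod t]]| <= N %/ t + 1)%N.
Proof.
move=> t0.
have hk (k : 'I_N) : (k %/ t < N %/ t + 1)%N by rewrite addn1 ltnS leq_div2r// ltnW.
rewrite -[leqRHS]card_ord.
apply: (@leq_card_in _ _ (fun k : 'I_N => Ordinal (hk k))) => // x y.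
rewrite !inE => /eqP jx /eqP jy /(congr1 val)/= xy.
by apply: val_inj; rewrite /= (divn_eq x t) (divn_eq y t) xy -jx -jy.
Qed.

(** Both congruences together are one congruence modulo the least common
    multiple, which has at most [N / lcm + 1] solutions k for each j. *)
Lemma card_congruent_pairs_le (R : realType) (N t t' : nat) : (0 < t)%N -> (0 < t')%N ->
  #|[pred jk : 'I_N * 'I_N | (jk.1 == jk.2 %[mod t]) && (jk.1 == jk.2 %[mod t'])]|%:R
  <= N%:R + N%:R ^+ 2 * (gcdn t t')%:R / (t%:R * t'%:R) :> R.
Proof.
move=> t0 t'0; set L := lcmn t t'.
have L0 : (0 < L)%N by rewrite lcmn_gt0 t0.
have h : (#|[pred jk : 'I_N * 'I_N | (jk.1 == jk.2 %[mod t]) && (jk.1 == jk.2 %[mod t'])]|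
          <= N * (N %/ L + 1))%N.
  rewrite -sum1_card (eq_bigl (fun jk : 'I_N * 'I_N => true && (jk.1 == jk.2 %[mod L])%N)).
    rewrite -(pair_big_dep xpredT (fun j k : 'I_N => (j == k %[mod L])%N) (fun _ _ => 1%N)).
    rewrite -[leqRHS](_ : \sum_(j < N) (N %/ L + 1) = _)%N; last by rewrite sum_nat_const card_ord.
    apply: leq_sum => j _; rewrite sum1_card; exact: card_congruent_le.
  move=> [j k]; rewrite unfold_in /=.
  wlog jk : j k / (k <= j)%N => [hw|].
    have [|/ltnW] := leqP k j; first exact: hw.
    by move=> /hw; rewrite eq_sym [X in _ && X]eq_sym [RHS]eq_sym.
  by rewrite !eqn_mod_dvd// dvdn_lcm.
rewrite (@le_trans _ _ (N * (N %/ L + 1))%:R)//; first by rewrite ler_nat.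
have g0 : (gcdn t t')%:R != 0 :> R by rewrite pnatr_eq0 -lt0n gcdn_gt0 t0.
have -> : t%:R * t'%:R = L%:R * (gcdn t t')%:R :> R by rewrite -!natrM muln_lcm_gcd.
rewrite invfM mulrACA divff// mulr1 natrM natrD mulrDr mulr1 addrC lerD2l.
rewrite expr2 -mulrA ler_wpM2l// ler_pdivlMr ?ltr0n// -natrM ler_nat.
exact: leq_divM.
Qed.

Section BilinearSums.
Variable R : realType.
Local Notation C := (CC R).

(** After Fourier expansion the sum over (j, k) factors, for each pair of
    frequencies, as the square of a sum over j < N of the product character.
    The squared absolute values of the latter are nonnegative, and their total
    over all frequencies is computed exactly by orthogonality. *)
Lemma bilinear_le (f g : nat -> C) (t t' N : nat) (M M' : R) :
  (0 < t)%N -> (0 < t')%N ->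
  (forall x, f (x %% t)%N = f x) -> (forall x, g (x %% t')%N = g x) ->
  (forall b, cabs (dft f t b) <= M) -> (forall b, cabs (dft g t' b) <= M') ->
  cabs (\sum_(j < N) \sum_(k < N) f (j + k)%N * (g (j + k)%N)^*)
  <= M * M' * #|[pred jk : 'I_N * 'I_N |
                 (jk.1 == jk.2 %[mod t]) && (jk.1 == jk.2 %[mod t'])]|%:R.
Proof.
move=> t0 t'0 fP gP fM gM.
pose chi (b : 'I_t * 'I_t') m : C := ez R t (b.1 * m)%N%:Z * (ez R t' (b.2 * m)%N%:Z)^*.
have chiD b m n : chi b (m + n)%N = chi b m * chi b n.
  by rewrite /chi !mulnDr !PoszD !ezD conjM; ring.
have fgE m : t%:R * t'%:R * (f m * (g m)^*) =
    \sum_(b : 'I_t * 'I_t') dft f t b.1 * (dft g t' b.2)^* * chi b m.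
  have -> : t%:R * t'%:R * (f m * (g m)^*) = t%:R * f m * (t'%:R * g m)^*.
    by rewrite conjM conjC_nat; ring.
  rewrite (@fourier_inversion _ f t)// (@fourier_inversion _ g t')// conj_sum.
  rewrite big_distrlr pair_bigA; apply: eq_bigr => b _.
  by rewrite /= conjM /chi; ring.
have tt0 : 0 < t%:R * t'%:R :> R by rewrite mulr_gt0 ?ltr0n.
rewrite -(ler_pM2l tt0).
have cabsl z : t%:R * t'%:R * cabs z = cabs (t%:R * t'%:R * z) by rewrite !cabsM !cabs_nat.
rewrite cabsl.
have -> : t%:R * t'%:R * (\sum_(j < N) \sum_(k < N) f (j + k)%N * (g (j + k)%N)^*) =
    \sum_(b : 'I_t * 'I_t') dft f t b.1 * (dft g t' b.2)^* * (\sum_(j < N) chi b j) ^+ 2.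
  rewrite mulr_sumr; under eq_bigr do rewrite mulr_sumr.
  under eq_bigr do under eq_bigr do rewrite fgE.
  rewrite pair_bigA exchange_big; apply: eq_bigr => b _ /=.
  rewrite expr2 big_distrlr pair_bigA mulr_sumr; apply: eq_bigr => jk _ /=.
  by rewrite chiD.
have key : \sum_b cabs (\sum_(j < N) chi b j) ^+ 2 = t%:R * t'%:R *
     #|[pred jk : 'I_N * 'I_N | (jk.1 == jk.2 %[mod t]) && (jk.1 == jk.2 %[mod t'])]|%:R.
  apply: toC_inj; rewrite toC_sum.
  under eq_bigr do rewrite cabs_sqr conj_sum big_distrlr pair_bigA.
  rewrite exchange_big/= -sum1_card natr_sum mulr_sumr toC_sum [RHS]big_mkcond.
  apply: eq_bigr => jk _.
  have -> : \sum_b chi b jk.1 * (chi b jk.2)^* =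
      (\sum_(b < t) ez R t ((jk.1%:Z - jk.2%:Z) *+ b)) *
      (\sum_(b < t') ez R t' ((jk.2%:Z - jk.1%:Z) *+ b)).
    rewrite big_distrlr pair_bigA; apply: eq_bigr => b _.
    rewrite /chi conjM conjCK -!ezN mulrACA -!ezD.
    by congr (ez R t _ * ez R t' _); rewrite !PoszM -mulr_natr natz; ring.
  rewrite !sum_ez// -!eqz_mod_dvd !modz_nat !eqz_nat unfold_in /= [X in _ * (if X then _ else _)]eq_sym.
  case: (_ == _); case: (_ == _); rewrite ?mulr0 ?mul0r ?mulr1//.
  by rewrite -!natrM toC_nat.
rewrite (le_trans (cabs_sum _ _ _))// mulrCA -key mulr_sumr; apply: ler_sum => b _.
rewrite 2!cabsM cabs_conj cabsX ler_wpM2r ?exprn_ge0 ?cabs_ge0//.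
by rewrite ler_pM ?cabs_ge0.
Qed.

Lemma unimodular_align (z : C) : exists th : C, cabs th = 1 /\ th * z = toC (cabs z).
Proof.
have [->|z0] := eqVneq z 0.
  by exists 1; rewrite (cabs_nat R 1) mul1r (cabs_nat R 0) (toC_nat R 0).
have n0 : cabs z != 0 by apply: contra z0; rewrite -(inj_eq (@toC_inj R)) -cabsE (toC_nat R 0) normr_eq0.
exists (z^* * toC (cabs z)^-1); split.
  by rewrite cabsM cabs_conj cabs_toC ?invr_ge0 ?cabs_ge0// divff.
rewrite mulrAC [z^* * z]mulrC -cabs_sqr -!rmorphM/= expr2 mulfK//.
Qed.

End BilinearSums.

(** * A large sieve inequality over the moduli *)

Lemma is_order_coprime (lam p t : nat) : (0 < p)%N -> is_order lam p t -> coprime lam p.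
Proof.
move=> p0 [t0 ht].
have /eqP h : (lam ^ t == lam ^ 0 %[mod p])%N by rewrite ht modnn mod0n.
rewrite /coprime -dvdn1.
have : (gcdn lam p %| lam ^ t)%N by rewrite -(prednK t0) expnS dvdn_mulr ?dvdn_gcdl.
rewrite /dvdn -(modn_dvdm (lam ^ t) (dvdn_gcdr lam p)) h.
by rewrite modn_dvdm// dvdn_gcdr.
Qed.

Lemma fexp_mod (R : realType) p a lam t : (0 < p)%N -> is_order lam p t ->
  forall x, fexp R p a lam (x %% t) = fexp R p a lam x.
Proof. by move=> p0 ht x; apply: (fexp_periodic R a p0 ht); rewrite modn_mod. Qed.

Section LargeSieve.
Variable R : realType.
Local Notation C := (CC R).

(** Each m in (S, 2S] is a sum j + k with j, k <= 2S in at least S ways: any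
    j < S will do. *)
Lemma sum_translate_le (S : nat) (F : nat -> R) : (forall m, 0 <= F m) ->
  S%:R * (\sum_(m < S) F (m.+1 + S)%N) <=
  \sum_(j < (2 * S).+1) \sum_(k < (2 * S).+1) F (j + k)%N.
Proof.
move=> F0.
have hj (x : 'I_S * 'I_S) : (x.2 < (2 * S).+1)%N by have := ltn_ord x.2; lia.
have hk (x : 'I_S * 'I_S) : (x.1.+1 + S - x.2 < (2 * S).+1)%N by have := ltn_ord x.1; lia.
have := @sum_inj_le R _ _ predT (fun x : 'I_S * 'I_S => (Ordinal (hj x), Ordinal (hk x)))
  (fun y : 'I_(2 * S).+1 * 'I_(2 * S).+1 => F (y.1 + y.2)%N).
rewrite pair_bigA => h; rewrite (le_trans _ (h _ _))//=.
- rewrite -(pair_bigA _ (fun m j : 'I_S => F (j + (m.+1 + S - j))%N))/= mulr_sumr.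
  apply: ler_sum => m _.
  under eq_bigr => j _ do (rewrite subnKC; last by have := ltn_ord j; lia).
  by rewrite sumr_const card_ord mulr_natl.
- move=> [m j] [m' j'] _ _ [/= jj mm]; move: mm (ltn_ord j) (ltn_ord j'); rewrite jj => mm h1 h2.
  by congr (_, _); apply: val_inj => //=; lia.
Qed.

(** The bound on average over the moduli. The two terms come from the two terms
    of [card_congruent_pairs_le], estimated with the two bounds for the
    Fourier coefficients, sqrt X and rho t_i respectively. Terms i = j need no
    separate treatment. *)
Lemma exp_sums_large_sieve (I : finType) (P : pred I) (p t : I -> nat) (a : I -> int)
    (lam T S : nat) (s : nat -> nat) (X rho : R) :
  0 <= X -> 0 <= rho -> (0 < S)%N ->
  (forall n, (1 <= n <= T)%N -> (1 <= s n <= S)%N) ->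
  (forall m n, (1 <= m)%N -> (m < n)%N -> (s m < s n)%N) ->
  (forall i, P i -> [/\ (0 < p i)%N, (p i)%:R <= X, coprimez (a i) (p i) & is_order lam (p i) (t i)]) ->
  (forall i b c, P i -> coprimez c (p i) ->
     cabs (dft (fexp R (p i) c lam) (t i) b) <= rho * (t i)%:R) ->
  (\sum_(i | P i) cabs (\sum_(1 <= n < T.+1) fexp R (p i) (a i) lam (s n))) ^+ 2 <=
  T%:R * (3 * #|P|%:R ^+ 2 * X +
          9 * rho ^+ 2 * S%:R * \sum_(i | P i) \sum_(j | P j) (gcdn (t i) (t j))%:R).
Proof.
move=> X0 rho0 S0 sS smono hP hrho.
pose sig i := \sum_(1 <= n < T.+1) fexp R (p i) (a i) lam (s n).
have [th hth] := choice (fun i => unimodular_align (sig i)).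
pose A m : C := \sum_(i | P i) th i * fexp R (p i) (a i) lam m.
(* multiplying a by this power shifts the exponents by S modulo t i, without
   inverting lam *)
pose a' i : int := a i * (lam ^ (S * (t i).-1))%N%:Z.
pose A' m : C := \sum_(i | P i) th i * fexp R (p i) (a' i) lam m.
have AA' m : A m = A' (m + S)%N.
  apply: eq_bigr => i /hP[p0 _ _ ht]; congr (_ * _).
  rewrite (@fexp_periodic R _ _ _ _ p0 ht m (m + t i * S)%N); last by rewrite addnC mulnC modnMDl.
  congr ez; rewrite /a' -mulrA -PoszM -expnD; congr (_ * (lam ^ _)%N%:Z).
  by have [/prednK <- _] := ht; rewrite mulSn /=; lia.
have a'P i : P i -> coprimez (a' i) (p i).
  move=> /hP[p0 _ ap ht]; rewrite coprimezMl ap/= /coprimez/= .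
  by rewrite -[_ == _]/(coprime _ _) coprimeXl// (is_order_coprime p0 ht).
(* both bounds at once, as the two terms of the counting bound need different
   ones *)
pose M i := Num.min (Num.sqrt X) (rho * (t i)%:R).
have M0 i : 0 <= M i by rewrite le_min sqrtr_ge0 mulr_ge0.
have hM i b : P i -> cabs (dft (fexp R (p i) (a' i) lam) (t i) b) <= M i.
  move=> Pi; have [p0 pX ap ht] := hP _ Pi; rewrite le_min hrho ?a'P// andbT.
  rewrite -(ler_pXn2r (n := 2))// ?nnegrE ?cabs_ge0 ?sqrtr_ge0// sqr_sqrtr//.
  by rewrite (le_trans _ pX)// dft_fexp_le_sqrt// a'P.
set N := (2 * S).+1.
set G := \sum_(i | P i) \sum_(j | P j) (gcdn (t i) (t j))%:R.
have G0 : 0 <= G by rewrite sumr_ge0// => i _; rewrite sumr_ge0.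
have step1 : (\sum_(i | P i) cabs (sig i)) ^+ 2 <= T%:R * \sum_(m < S) cabs (A m.+1) ^+ 2.
  have -> : \sum_(i | P i) cabs (sig i) = cabs (\sum_(n < T) A (s n.+1)).
    rewrite -[LHS]cabs_toC; last by rewrite sumr_ge0// => *; rewrite cabs_ge0.
    congr cabs; rewrite toC_sum.
    under eq_bigr => i _ do rewrite -(hth i).2 mulr_sumr.
    rewrite exchange_big/= big_add1 big_mkord; by apply: eq_bigr => n _.
  apply: (@le_trans _ _ ((\sum_(n < T) cabs (A (s n.+1))) ^+ 2)).
    by rewrite lerXn2r// ?nnegrE ?cabs_ge0 ?cabs_sum// sumr_ge0// => *; rewrite cabs_ge0.
  apply: (le_trans (sqr_sum_le _ _)); rewrite card_ord ler_wpM2l//.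
  have hs (n : 'I_T) : ((s n.+1).-1 < S)%N.
    by have := sS n.+1; have := ltn_ord n => h /(_ h) /andP[]; case: (s n.+1).
  have sinj : injective (fun n : 'I_T => Ordinal (hs n)).
    move=> x y /(congr1 val)/= xy; apply: val_inj => /=.
    have /andP[x1 _] := sS x.+1 (ltn_ord x); have /andP[y1 _] := sS y.+1 (ltn_ord y).
    have [lt|lt|//] := ltngtP x y.
      by have := @smono x.+1 y.+1 isT lt; lia.
    by have := @smono y.+1 x.+1 isT lt; lia.
  have := @sum_inj_le R _ _ predT _ (fun m : 'I_S => cabs (A m.+1) ^+ 2) (in2W sinj).
  move=> /(_ (fun _ => exprn_ge0 _ (cabs_ge0 _))); apply: le_trans.
  apply: ler_sum => n _ /=; rewrite prednK//.
  by have /andP[] := sS n.+1 (ltn_ord n).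
have step2 : S%:R * (\sum_(m < S) cabs (A m.+1) ^+ 2) <=
    #|P|%:R ^+ 2 * X * N%:R + rho ^+ 2 * N%:R ^+ 2 * G.
  under eq_bigr do rewrite AA'.
  apply: (le_trans (@sum_translate_le S (fun m => cabs (A' m) ^+ 2) _)) => [m|]; first by rewrite exprn_ge0 ?cabs_ge0.
  rewrite pair_bigA/= -[leLHS]cabs_toC; last by rewrite sumr_ge0// => *; rewrite exprn_ge0 ?cabs_ge0.
  rewrite toC_sum.
  have -> : \sum_(jk : 'I_N * 'I_N) toC (cabs (A' (jk.1 + jk.2)%N) ^+ 2) =
      \sum_(i | P i) \sum_(i' | P i') th i * (th i')^* *
        (\sum_(j < N) \sum_(k < N) fexp R (p i) (a' i) lam (j + k) *
                                   (fexp R (p i') (a' i') lam (j + k))^*).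
    under eq_bigr do rewrite cabs_sqr conj_sum big_distrlr.
    rewrite exchange_big/=; apply: eq_bigr => i _; rewrite exchange_big/=.
    apply: eq_bigr => i' _; rewrite pair_bigA mulr_sumr.
    by apply: eq_bigr => jk _ /=; rewrite conjM; ring.
  apply: (le_trans (cabs_sum _ _ _)).
  rewrite [leRHS](_ : _ = \sum_(i | P i) \sum_(j | P j)
      (X * N%:R + rho ^+ 2 * N%:R ^+ 2 * (gcdn (t i) (t j))%:R)); last first.
    under [RHS]eq_bigr do rewrite big_split/= sumr_const -mulr_sumr.
    by rewrite big_split/= sumr_const -mulr_sumr -/G -mulrnA -[X in _ = X + _]mulr_natl natrM; ring.
  apply: ler_sum => i Pi; apply: (le_trans (cabs_sum _ _ _)); apply: ler_sum => j Pj.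
  rewrite 2!cabsM cabs_conj !(hth _).1 !mul1r.
  have [pi0 _ _ hti] := hP _ Pi; have [pj0 _ _ htj] := hP _ Pj.
  have [ti0 _] := hti; have [tj0 _] := htj.
  apply: (le_trans (@bilinear_le R _ _ (t i) (t j) N (M i) (M j) ti0 tj0 _ _ _ _)).
  - exact: fexp_mod.
  - exact: fexp_mod.
  - by move=> b; exact: hM.
  - by move=> b; exact: hM.
  apply: (le_trans (ler_wpM2l _ (card_congruent_pairs_le R N ti0 tj0))); first by rewrite mulr_ge0.
  rewrite mulrDr lerD//.
    rewrite ler_wpM2r// -[leRHS](sqr_sqrtr X0) expr2 ler_pM// ge_min lexx//.
  rewrite mulrA ler_pdivrMr ?mulr_gt0 ?ltr0n//.
  rewrite [leRHS](_ : _ = (rho * (t i)%:R) * (rho * (t j)%:R) * (N%:R ^+ 2 * (gcdn (t i) (t j))%:R)); last by ring.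
  rewrite ler_wpM2r ?mulr_ge0 ?exprn_ge0// ler_pM// ge_min lexx orbT//.
have SR : 0 < S%:R :> R by rewrite ltr0n.
apply: (le_trans step1); rewrite ler_wpM2l// -(ler_pM2l SR).
apply: (le_trans step2).
have N3 : N%:R <= 3 * S%:R :> R by rewrite -natrM ler_nat /N; lia.
rewrite mulrDr lerD//.
  rewrite [leRHS](_ : _ = #|P|%:R ^+ 2 * X * (3 * S%:R)); last by ring.
  by rewrite ler_wpM2l// mulr_ge0 ?exprn_ge0.
rewrite [leRHS](_ : _ = rho ^+ 2 * (3 * S%:R) ^+ 2 * G); last by ring.
rewrite ler_wpM2r// ler_wpM2l ?exprn_ge0// lerXn2r// nnegrE ?mulr_ge0//.
Qed.

End LargeSieve.

(** * Counting primes with small order or large energy *)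

Local Open Scope nat_scope.

(** Euler's theorem for existence, then division with remainder. *)
Lemma exists_order (lam p : nat) : prime p -> ~~ (p %| lam) ->
  exists2 t, is_order lam p t & t %| p.-1.
Proof.
move=> pp plam.
have cop : coprime lam p by rewrite coprime_sym prime_coprime.
have p1 : 1 < p by exact: prime_gt1.
have ex : exists t, (0 < t) && (lam ^ t == 1 %[mod p]).
  exists p.-1; rewrite -ltnS prednK ?prime_gt0// p1/=.
  by rewrite -totient_prime// Euler_exp_totient.
case: (ex_minnP ex) => t /andP[t0 /eqP ht] tmin.
have lamD m : lam ^ m = lam ^ (m %% t) %[mod p].
  rewrite {1}(divn_eq m t) expnD mulnC [_ %/ _ * _]mulnC expnM -modnMmr.
  by rewrite -modnXm ht modnXm exp1n modnMmr muln1.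
have ht1 m : (lam ^ m == 1 %[mod p]) = (t %| m).
  rewrite lamD; apply/idP/idP => [h|/eqP ->]; last by rewrite expn0.
  rewrite /dvdn -leqn0 leqNgt; apply/negP => m0.
  by have := tmin (m %% t); rewrite m0 h => /(_ isT); rewrite leqNgt ltn_mod t0.
have hle j k : j <= k -> (lam ^ j == lam ^ k %[mod p]) = (j == k %[mod t]).
  move=> jk; rewrite eq_sym [RHS]eq_sym eqn_mod_dvd; last first.
    by rewrite leq_pexp2l// lt0n; apply: contra plam => /eqP ->.
  rewrite eqn_mod_dvd// -{1}(subnK jk) expnD -{2}[lam ^ j]mul1n -mulnBl.
  rewrite Gauss_dvdl; last by rewrite coprime_sym coprimeXl.
  rewrite -ht1 eqn_mod_dvd// expn_gt0 lt0n.
  by apply/orP; left; apply: contra plam => /eqP ->.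
exists t.
  split=> // j k; case: (leqP j k) => [/hle //|/ltnW /hle].
  by rewrite eq_sym => ->; rewrite eq_sym.
by rewrite -ht1 -totient_prime// Euler_exp_totient.
Qed.

Lemma exp2_size_primes_le (m : nat) : 0 < m -> 2 ^ size (primes m) <= m.
Proof.
move=> m0; rewrite [leqRHS](prod_prime_decomp m0) /primes size_map.
have : {in prime_decomp m, forall f, 2 <= f.1 ^ f.2}.
  move=> [q e] /mem_prime_decomp[qp e0 _] /=.
  by rewrite (leq_trans (prime_gt1 qp))// -[leqLHS]expn1 leq_pexp2l// prime_gt0.
elim: (prime_decomp m) => [|f s IHs] hs; first by rewrite big_nil.
rewrite big_cons expnS leq_mul ?hs ?mem_head// IHs// => g gs.
by rewrite hs// inE gs orbT.
Qed.

(** The product of the distinct prime factors is at least 2 to their number. *)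
Lemma card_prime_divisors_le (n m k : nat) : 0 < m -> m <= 2 ^ k ->
  #|[pred p : 'I_n | prime p && (p %| m)]| <= k.
Proof.
move=> m0 mk.
apply: (@leq_trans (size (primes m))); last first.
  by rewrite -(@leq_exp2l 2)// (leq_trans (exp2_size_primes_le m0)).
rewrite cardE -(size_map val); apply: uniq_leq_size.
  by rewrite map_inj_uniq ?enum_uniq//; exact: val_inj.
by move=> q /mapP[x]; rewrite mem_enum inE => /andP[xp xm] ->; rewrite mem_primes xp m0.
Qed.

(** Crude, but it avoids logarithms to the base lam. *)
Lemma expn_le_exp2 (lam j : nat) : lam ^ j <= 2 ^ (lam * j).
Proof. by rewrite expnM; case: j => // j; rewrite leq_exp2r// ltnW// ltn_expl. Qed.

(** A prime modulo which lam has order j at most Y divides lam ^ j - 1, which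
    has O(j) prime factors. *)
Lemma card_small_order_le (n lam Y : nat) : 1 < lam ->
  #|[pred p : 'I_n | prime p && [exists j : 'I_Y, lam ^ j.+1 == 1 %[mod p]]]|
  <= lam * Y ^ 2.
Proof.
move=> lam1.
apply: (@leq_trans (\sum_(j < Y) #|[pred p : 'I_n | prime p && (p %| lam ^ j.+1 - 1)]|)).
  rewrite -sum1_card.
  under [leqRHS]eq_bigr do rewrite -sum1_card big_mkcond.
  rewrite exchange_big big_mkcond; apply: leq_sum => p _.
  rewrite inE; case: ifP => // /andP[pp /existsP[j hj]].
  rewrite (bigD1 j)//= inE pp -eqn_mod_dvd ?hj//.
  by rewrite expn_gt0 (ltnW lam1).
apply: (@leq_trans (\sum_(j < Y) lam * Y)); last by rewrite sum_nat_const card_ord -mulnn mulnCA.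
apply: leq_sum => j _; apply: card_prime_divisors_le.
  by rewrite subn_gt0 -[1]/(lam ^ 0) ltn_exp2l.
apply: (leq_trans (leq_subr _ _)); apply: (leq_trans (expn_le_exp2 _ _)).
by rewrite leq_exp2l// leq_mul2l ltn_ord orbT.
Qed.

(** The larger exponent is determined by the sum: the smaller power at most
    doubles the larger one, and 2 <= lam. *)
Lemma sum_two_powers_max (lam a b c d : nat) : 1 < lam ->
  b <= a -> d <= c -> lam ^ a + lam ^ b = lam ^ c + lam ^ d -> a <= c.
Proof.
move=> lam1 ba dc h; rewrite leqNgt; apply/negP => ca.
have h1 : lam ^ c + lam ^ d <= lam ^ a.
  apply: (@leq_trans (lam * lam ^ c)).
    apply: (@leq_trans (2 * lam ^ c)); last by rewrite leq_mul2r lam1 orbT.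
    by rewrite mul2n -addnn leq_add2l leq_exp2l.
  by rewrite -expnS leq_exp2l.
have : 0 < lam ^ b by rewrite expn_gt0 (ltnW lam1).
lia.
Qed.

Lemma sum_two_powers_inj (lam a b c d : nat) : 1 < lam ->
  lam ^ a + lam ^ b = lam ^ c + lam ^ d -> (a = c /\ b = d) \/ (a = d /\ b = c).
Proof.
move=> lam1.
have H x y z w : y <= x -> w <= z -> lam ^ x + lam ^ y = lam ^ z + lam ^ w -> x = z /\ y = w.
  move=> yx wz h.
  have xz : x = z.
    apply/eqP; rewrite eqn_leq (sum_two_powers_max lam1 yx wz h).
    by rewrite (sum_two_powers_max lam1 wz yx (esym h)).
  split=> //; move/eqP: h; rewrite xz eqn_add2l eqn_exp2l// => /eqP //.
case: (leqP b a) => [ba|/ltnW ab]; case: (leqP d c) => [dc|/ltnW cd] h.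
- by left; exact: H.
- by right; apply: (H _ _ _ _ ba cd); rewrite h addnC.
- by right; apply/and_comm; apply: (H _ _ _ _ ab dc); rewrite addnC.
- by left; apply/and_comm; apply: (H _ _ _ _ ab cd); rewrite addnC h addnC.
Qed.

(** For the 2 K^2 trivial solutions over the integers every prime is counted;
    any other quadruple contributes only the prime divisors of a nonzero
    integer below lam ^ K, of which there are O(K). *)
Lemma sum_energy_le (n lam K : nat) : 1 < lam ->
  \sum_(p < n | prime p) energy lam p K <=
  2 * K ^ 2 * #|[pred p : 'I_n | prime p]| + lam * K ^ 5.
Proof.
move=> lam1.
pose sm (x : 'I_K * 'I_K) := lam ^ x.1 + lam ^ x.2.
have -> : \sum_(p < n | prime p) energy lam p K =
  \sum_(q : ('I_K * 'I_K) * ('I_K * 'I_K))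
     #|[pred p : 'I_n | prime p && (sm q.1 == sm q.2 %[mod p])]|.
  under eq_bigr do rewrite /energy -sum1_card big_mkcond.
  rewrite exchange_big; apply: eq_bigr => q _.
  rewrite -sum1_card [RHS]big_mkcond [LHS]big_mkcond; apply: eq_bigr => p _.
  by rewrite !inE; case: (prime p).
have h q : #|[pred p : 'I_n | prime p && (sm q.1 == sm q.2 %[mod p])]| <=
    (if sm q.1 == sm q.2 then #|[pred p : 'I_n | prime p]| else 0) + lam * K.
  case: eqVneq => [e|ne].
    by apply: leq_trans (leq_addr _ _); apply/subset_leq_card/fintype.subsetP => p; rewrite !inE => /andP[].
  have bnd x : 0 < sm x <= 2 ^ (lam * K).
    rewrite addn_gt0 expn_gt0 (ltnW lam1)/= (leq_trans _ (expn_le_exp2 _ _))//.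
    have K0 : 0 < K by case: x => -[x hx] _; apply: leq_ltn_trans hx.
    apply: (@leq_trans (lam * lam ^ K.-1)); last by rewrite -expnS prednK.
    apply: (@leq_trans (2 * lam ^ K.-1)); last by rewrite leq_mul2r lam1 orbT.
    by rewrite mul2n -addnn leq_add// leq_exp2l// -ltnS prednK.
  wlog lt : q ne / sm q.2 < sm q.1.
    move=> hw; have [lt|] := ltnP (sm q.2) (sm q.1); first exact: hw.
    rewrite leq_eqVlt (negbTE ne)/= => lt.
    have := hw (q.2, q.1); rewrite eq_sym => /(_ ne lt)/=.
    apply: leq_trans; apply/subset_leq_card/fintype.subsetP => p; rewrite !inE.
    by move=> /andP[->] /=; rewrite eq_sym.
  rewrite add0n (leq_trans _ (@card_prime_divisors_le n (sm q.1 - sm q.2) (lam * K) _ _))//.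
  - apply/subset_leq_card/fintype.subsetP => p; rewrite !inE.
    by rewrite eqn_mod_dvd// ltnW.
  - by rewrite subn_gt0.
  - by rewrite (leq_trans (leq_subr _ _))//; have /andP[] := bnd q.1.
apply: (@leq_trans (\sum_(q : ('I_K * 'I_K) * ('I_K * 'I_K))
  ((if sm q.1 == sm q.2 then #|[pred p : 'I_n | prime p]| else 0) + lam * K))).
  by apply: leq_sum => q _; exact: h.
rewrite big_split/= sum_nat_const !card_prod card_ord leq_add//; last first.
  by rewrite !expnS expn0 muln1; apply: eq_leq; ring.
rewrite -big_mkcond/= sum_nat_const mulnC [leqRHS]mulnC leq_mul2l; apply/orP; right.
have -> : 2 * K ^ 2 = #|{: bool * ('I_K * 'I_K)}| by rewrite !card_prod card_bool card_ord -mulnn.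
pose sw (x : bool * ('I_K * 'I_K)) : ('I_K * 'I_K) * ('I_K * 'I_K) :=
  (x.2, if x.1 then x.2 else (x.2.2, x.2.1)).
apply: (leq_trans _ (leq_image_card sw _)).
apply/subset_leq_card/fintype.subsetP => -[[a b] [c d]]; rewrite unfold_in /= => /eqP.
move=> /(sum_two_powers_inj lam1)/= [[/val_inj -> /val_inj ->]|[/val_inj -> /val_inj ->]].
  by apply/fintype.imageP; exists (true, (c, d)).
by apply/fintype.imageP; exists (false, (d, c)).
Qed.

(** Bound the gcd by the sum of all common divisors d and exchange the sums:
    n / d numbers up to n are multiples of d. *)
Lemma sum_gcdn_le (n : nat) :
  \sum_(u < n) \sum_(v < n) gcdn u.+1 v.+1 <= \sum_(1 <= d < n.+1) d * (n %/ d) ^ 2.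
Proof.
have cnt d : n %/ d = \sum_(u < n) (d %| u.+1).
  by rewrite divn_count_dvd big_add1 big_mkord.
apply: (@leq_trans (\sum_(u < n) \sum_(v < n) \sum_(1 <= d < n.+1)
     d * ((d %| u.+1) * (d %| v.+1)))).
  apply: leq_sum => u _; apply: leq_sum => v _.
  have g0 : 0 < gcdn u.+1 v.+1 by rewrite gcdn_gt0.
  have gn : gcdn u.+1 v.+1 < n.+1.
    by rewrite ltnS (leq_trans (dvdn_leq _ (dvdn_gcdl _ _))).
  rewrite (bigD1_seq (gcdn u.+1 v.+1)) ?iota_uniq ?mem_index_iota ?g0//=.
  by rewrite dvdn_gcdl dvdn_gcdr muln1 leq_addr.
apply: eq_leq.
transitivity (\sum_(u < n) \sum_(1 <= d < n.+1) \sum_(v < n)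
     d * ((d %| u.+1) * (d %| v.+1))).
  by apply: eq_bigr => u _; exact: exchange_big.
rewrite exchange_big; apply: eq_bigr => d _.
rewrite cnt -mulnn big_distrlr/= big_distrr; apply: eq_bigr => u _.
by rewrite big_distrr.
Qed.

Local Open Scope ring_scope.

(** * Lower bound for the number of primes *)

Lemma exp2_le_central_bin (n : nat) : (2 ^ n <= 'C(n.*2, n))%N.
Proof.
elim: n => [|n IHn]; first by rewrite bin0.
rewrite doubleS binS (_ : 'C(n.*2.+1, n.+1) = 'C(n.*2.+1, n)); last first.
  by rewrite -bin_sub ?ltnS -?addnn ?leq_addr//; congr 'C(_, _); lia.
rewrite addnn expnS mul2n leq_double (leq_trans IHn)//.
by case: n {IHn} => // n; rewrite binS leq_addr.
Qed.

(** By Legendre's formula the valuation is a sum of differences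
    [2n / p^k] - 2 [n / p^k], which are at most 1, and vanish once p^k > 2n. *)
Lemma pfactor_central_bin_le (p n : nat) : prime p -> (0 < n)%N ->
  (p ^ logn p 'C(n.*2, n) <= n.*2)%N.
Proof.
move=> pp n0; have p1 := prime_gt1 pp.
have n20 : (0 < n.*2)%N by rewrite double_gt0.
apply: leq_trans (trunc_logP p1 n20); rewrite leq_pexp2l ?prime_gt0//.
set L := trunc_log p n.*2.
have hC : (logn p (n.*2)`! = logn p 'C(n.*2, n) + (logn p n`!).*2)%N.
  rewrite -(@bin_fact n.*2 n) -?addnn ?leq_addr// addnK !lognM ?muln_gt0 ?fact_gt0 ?addnn//.
  by rewrite bin_gt0 -addnn leq_addr.
have hn : (logn p n`! = \sum_(1 <= k < n.*2.+1) n %/ p ^ k)%N.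
  rewrite logn_fact// [RHS](big_cat_nat _ (n := n.+1))//=; last by rewrite ltnS -addnn leq_addr.
  rewrite [X in (_ + X)%N]big1_seq ?addn0// => k.
  rewrite mem_index_iota => /andP[_ /andP[nk _]].
  by rewrite divn_small// (leq_trans nk)// ltnW// ltn_expl.
suff h : (logn p (n.*2)`! <= L + (logn p n`!).*2)%N by rewrite hC leq_add2r in h.
rewrite hn logn_fact//.
have hL m : (\sum_(1 <= k < m.+1) (k <= L) = minn m L)%N.
  elim: m => [|m IHm]; first by rewrite big_geq// min0n.
  by rewrite big_nat_recr//= IHm; lia.
apply: (@leq_trans (\sum_(1 <= k < n.*2.+1) ((k <= L) + (n %/ p ^ k).*2))%N).
  apply: leq_sum => k _; have [kL|Lk] := leqP k L.
    by rewrite /= add1n -addn1 -!addnn leq_divDl.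
  by rewrite divn_small// (leq_trans (trunc_log_ltn _ p1))// leq_pexp2l ?prime_gt0.
rewrite big_split/= hL leq_add ?geq_minr// -!muln2 big_distrl/=.
by apply: leq_sum => k _; rewrite muln2.
Qed.

(** The central binomial coefficient is at least 2 ^ n and is a product of at
    most pi(2n) prime powers, each at most 2n. *)
Lemma exp2_le_primes (n : nat) : (0 < n)%N ->
  (2 ^ n <= n.*2 ^ #|[pred p : 'I_n.*2.+1 | prime p]|)%N.
Proof.
move=> n0; have n20 : (0 < n.*2)%N by rewrite double_gt0.
have C0 : (0 < 'C(n.*2, n))%N by rewrite bin_gt0 -addnn leq_addr.
set D := 'C(n.*2, n) in C0 *.
apply: (leq_trans (exp2_le_central_bin n)); rewrite -/D.
apply: (@leq_trans (n.*2 ^ size (primes D))); last first.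
  rewrite leq_pexp2l//.
  rewrite cardE -(size_map val); apply: uniq_leq_size; first exact: primes_uniq.
  move=> q; rewrite mem_primes => /and3P[qp _ qD]; apply/mapP.
  have qn : (q < n.*2.+1)%N.
    rewrite ltnS (leq_trans _ (pfactor_central_bin_le qp n0))// -[leqLHS]expn1.
    by apply: leq_pexp2l; rewrite ?(prime_gt0 qp)// logn_gt0 mem_primes qp C0.
  by exists (Ordinal qn) => //; rewrite mem_enum inE.
rewrite [leqLHS](prod_prime_decomp C0) /primes size_map.
have : {in prime_decomp D, forall f, (f.1 ^ f.2 <= n.*2)%N}.
  move=> f; rewrite prime_decompE => /mapP[q]; rewrite mem_primes => /andP[qp _] ->/=.
  exact: pfactor_central_bin_le.
elim: (prime_decomp D) => [|f s IHs] hs; first by rewrite big_nil.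
rewrite big_cons expnS leq_mul ?hs ?mem_head// IHs// => g gs.
by rewrite hs// inE gs orbT.
Qed.

Section RealCounting.
Variable R : realType.
Implicit Types (X x y : R).

Lemma ln_le_sub1 x : 0 < x -> ln x <= x - 1.
Proof.
by move=> x0; rewrite -{1}[x](subrK 1) addrC le_ln1Dx// ltrBrDl subrr.
Qed.

Lemma harmonic_le (n : nat) : (0 < n)%N ->
  \sum_(1 <= d < n.+1) d%:R^-1 <= 1 + ln n%:R :> R.
Proof.
elim: n => // -[|n] IHn _; first by rewrite big_nat1 invr1 ln1 addr0.
rewrite big_nat_recr//=.
have := IHn isT.
set A := \sum_(_ <= _ < _) _.
have a0 : 0 < n.+1%:R :> R by rewrite ltr0n.
have b0 : 0 < n.+2%:R :> R by rewrite ltr0n.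
have := @ln_le_sub1 (n.+1%:R / n.+2%:R) (divr_gt0 a0 b0).
rewrite ln_div ?posrE//.
have -> : n.+1%:R / n.+2%:R - 1 = - n.+2%:R^-1 :> R.
  rewrite -[X in X / _ - 1](addrK 1) natr1 mulrBl divff ?gt_eqF// mul1r.
  by rewrite addrAC subrr add0r.
have H (a b c d : R) : a - b <= - d -> c <= 1 + a -> c + d <= 1 + b by lra.
exact: H.
Qed.

Lemma count_primesE X (P : pred nat) :
  count_primes X P = #|[pred p : 'I_(Num.truncn X).+1 | prime p && P p]|.
Proof.
rewrite /count_primes; apply: eq_card => p.
by apply/idP/idP; rewrite !inE.
Qed.

(** Chebyshev's lower bound. *)
Lemma prime_pi_ge X : 4 <= X -> X / 8 <= (prime_pi X)%:R * ln X.
Proof.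
move=> X4.
have X0 : 0 <= X by lra.
rewrite /prime_pi count_primesE.
set m := Num.truncn X; set n := m./2.
have mX : m%:R <= X by rewrite truncn_le.
have Xm : X < m%:R + 1 by have /andP[_] := truncn_itv X0; rewrite -natr1.
have m4 : (4 <= m)%N by rewrite truncn_ge_nat.
have n0 : (0 < n)%N by rewrite half_gt0; lia.
have nm : (n.*2 <= m)%N by rewrite -[leqRHS]odd_double_half leq_addl.
have mn : m%:R <= n%:R * 2 + 1 :> R.
  rewrite -natrM natr1 ler_nat -[leqLHS]odd_double_half muln2 -/n.
  by case: (odd m).
set pn := #|_|.
have := exp2_le_primes n0.
have : (#|[pred p : 'I_n.*2.+1 | prime p]| <= pn)%N.
  have winj : injective (widen_ord (nm : (n.*2.+1 <= m.+1)%N)).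
    by move=> x y /(congr1 val)/= /val_inj.
  rewrite -(fintype.card_image winj).
  apply/subset_leq_card/fintype.subsetP => p /fintype.imageP[q]; rewrite !inE => qp ->.
  by rewrite /= qp.
move=> h1 h2.
have n2 : (1 < n.*2)%N by rewrite -addnn; lia.
have h3 : (2 ^ n <= n.*2 ^ pn)%N by rewrite (leq_trans h2)// leq_pexp2l// ltnW.
have n2R : 1 <= n.*2%:R :> R by rewrite ler1n ltnW.
have h4 : n%:R * ln 2 <= pn%:R * ln n.*2%:R :> R.
  rewrite -!ln_powR -[leLHS]/(ln _) !powR_mulrn// -!natrX.
  by rewrite ler_ln ?posrE ?ltr0n ?expn_gt0 ?double_gt0 ?n0// ler_nat.
have h5 : ln n.*2%:R <= ln X.
  rewrite ler_ln ?posrE ?ltr0n ?double_gt0//; last lra.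
  by rewrite (le_trans _ mX)// ler_nat.
have h6 : 1 / 2 <= ln 2 :> R.
  have := @ln_le_sub1 (2^-1) ltac:(lra); rewrite lnV ?posrE//; lra.
have h7 : n%:R * (1 / 2) <= n%:R * ln 2 :> R by rewrite ler_wpM2l.
have h8 : pn%:R * ln n.*2%:R <= pn%:R * ln X :> R by rewrite ler_wpM2l.
lra.
Qed.

Lemma sum_gcdn_le_log X (n : nat) : n%:R <= X -> (0 < n)%N ->
  \sum_(u < n) \sum_(v < n) (gcdn u.+1 v.+1)%:R <= X ^+ 2 * (1 + ln X).
Proof.
move=> nX n0.
have X0 : 0 < X by rewrite (lt_le_trans _ nX)// ltr0n.
apply: (@le_trans _ _ (n%:R ^+ 2 * (1 + ln n%:R))); last first.
  rewrite ler_pM ?exprn_ge0//.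
  - by rewrite addr_ge0// ln_ge0// ler1n.
  - by rewrite lerXn2r// nnegrE// ltW.
  - by rewrite lerD2l ler_ln ?posrE ?ltr0n.
apply: (@le_trans _ _ (n%:R ^+ 2 * \sum_(1 <= d < n.+1) d%:R^-1)); last first.
  by rewrite ler_wpM2l ?exprn_ge0// harmonic_le.
have := sum_gcdn_le n; rewrite -(ler_nat R) !natr_sum => h.
under eq_bigr do rewrite -natr_sum.
apply: (le_trans h); rewrite mulr_sumr big_nat [leRHS]big_nat.
apply: ler_sum => d /andP[d0 _].
have dR : 0 < d%:R :> R by rewrite ltr0n.
rewrite natrM natrX ler_pdivlMr//.
rewrite (_ : d%:R * _ * d%:R = (d%:R * (n %/ d)%:R) ^+ 2); last by ring.
by rewrite lerXn2r// ?nnegrE// -?natrM ?ler_nat// mulnC leq_divM.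
Qed.

End RealCounting.

(** * Exceptional primes with generic order and energy *)

Section GoodPrimes.
Variable R : realType.
Implicit Types (X rho W E : R).

Lemma cabs_expsumE (lam : nat) (s : nat -> nat) (T p : nat) (a : int) :
  complex.Re `|expsum R lam s T p a| =
  cabs (\sum_(1 <= n < T.+1) fexp R p a lam (s n)).
Proof.
rewrite /fexp /ez /expsum.
transitivity (cabs (\sum_(1 <= n < T.+1)
   (expi2pi (a%:~R * lam%:R ^+ s n / p%:R : R) : CC R))); first by [].
congr cabs; apply: eq_bigr => n _; congr (expi2pi (_ / _)).
by rewrite intrM -natrX.
Qed.

(** The supremum is approached, so a frequency witnesses any strict lower
    bound. *)
Lemma lt_max_expsum (lam : nat) (s : nat -> nat) (T p : nat) W :
  W < max_expsum R lam s T p ->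
  exists a : int, coprimez a p /\
    W < cabs (\sum_(1 <= n < T.+1) fexp R p a lam (s n)).
Proof.
move=> hW; apply: contrapT => hn; move: hW; apply/negP; rewrite -leNgt.
apply: ge_sup.
  by exists (complex.Re `|expsum R lam s T p 1|); exists 1 => //; rewrite /= coprimezE coprime1n.
move=> _ [a ap <-]; rewrite cabs_expsumE leNgt; apply/negP => h.
by apply: hn; exists a.
Qed.

(** The orders divide p - 1, and the p - 1 are distinct positive integers. *)
Lemma sum_gcd_orders_le (n : nat) (P : pred 'I_n.+1) (t : 'I_n.+1 -> nat) X :
  n%:R <= X -> (0 < n)%N ->
  (forall i, P i -> (1 < i)%N /\ (t i %| i.-1)%N) ->
  \sum_(i | P i) \sum_(j | P j) (gcdn (t i) (t j))%:R <= X ^+ 2 * (1 + ln X).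
Proof.
move=> nX n0 hP; apply: le_trans (sum_gcdn_le_log nX n0).
case: n n0 P t nX hP => // n _ P t nX hP.
pose h (i : 'I_n.+2) : 'I_n.+1 := inord i.-2.
have hE i : P i -> (h i).+1 = i.-1.
  by move=> /hP[i1 _]; rewrite /h inordK; have := ltn_ord i; lia.
have hI : {in P &, injective h}.
  move=> i j Pi Pj /(congr1 (fun x : 'I_n.+1 => x.+1)); rewrite !hE// => ij.
  have [i1 _] := hP _ Pi; have [j1 _] := hP _ Pj; apply: val_inj => /=; lia.
have gle i j : P i -> P j -> (gcdn (t i) (t j))%:R <= (gcdn (h i).+1 (h j).+1)%:R :> R.
  move=> Pi Pj; rewrite ler_nat !hE//; have [i1 ti] := hP _ Pi; have [j1 tj] := hP _ Pj.
  apply: dvdn_leq; first by rewrite gcdn_gt0; apply/orP; left; lia.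
  by rewrite dvdn_gcd (dvdn_trans (dvdn_gcdl _ _) ti) (dvdn_trans (dvdn_gcdr _ _) tj).
apply: (@le_trans _ _ (\sum_(i | P i) \sum_(v < n.+1) (gcdn (h i).+1 v.+1)%:R)).
  apply: ler_sum => i Pi.
  apply: le_trans (sum_inj_le (F := fun v : 'I_n.+1 => (gcdn (h i).+1 v.+1)%:R) hI _) => //.
  by apply: ler_sum => j Pj; exact: gle.
apply: (@sum_inj_le _ _ _ P h (fun u : 'I_n.+1 => \sum_(v < n.+1) (gcdn u.+1 v.+1)%:R) hI).
by move=> u; rewrite sumr_ge0.
Qed.

(** [dft_fexp_le_energy] in the normalised form required by
    [exp_sums_large_sieve], for a prime with small energy and order above Y. *)
Lemma dft_fexp_le_rho (p t lam b K Y : nat) (a : int) X rho E :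
  0 <= rho -> (0 < K)%N -> (0 < p)%N -> p%:R <= X -> coprimez a p -> is_order lam p t ->
  (Y < t)%N -> (energy lam p K)%:R <= E ->
  X * E <= rho ^+ 4 * K%:R ^+ 4 * Y.+1%:R ->
  cabs (dft (fexp R p a lam) t b) <= rho * t%:R.
Proof.
move=> rho0 K0 p0 pX ap ht Yt hE num.
have := dft_fexp_le_energy R b K p0 ap ht.
set f := cabs _ => h.
have f0 : 0 <= f by exact: cabs_ge0.
have KR : 0 < K%:R :> R by rewrite ltr0n.
have X0 : 0 <= X by apply: le_trans pX.
rewrite -(ler_pXn2r (n := 4))// ?nnegrE ?mulr_ge0//.
rewrite -(ler_pM2l (exprn_gt0 4 KR)) -exprMn (le_trans h)//.
rewrite (_ : K%:R ^+ 4 * (rho * t%:R) ^+ 4 = t%:R ^+ 3 * (rho ^+ 4 * K%:R ^+ 4 * t%:R)); last by ring.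
rewrite ler_wpM2l ?exprn_ge0//.
apply: (@le_trans _ _ (X * E)); first by rewrite ler_pM.
apply: (le_trans num); rewrite ler_wpM2l ?mulr_ge0 ?exprn_ge0 ?(ltW KR)//.
by rewrite ler_nat.
Qed.

(** The large sieve applied to a set P of primes, all satisfying the generic
    bounds on order and energy, at each of which the exponential sum exceeds W
    for some frequency. *)
Lemma good_exceptional_le (lam T S K Y n : nat) (s : nat -> nat) (P : pred 'I_n.+1)
    X rho W E :
  0 <= rho -> 0 <= W -> (0 < K)%N -> (0 < S)%N -> (0 < n)%N -> n%:R <= X ->
  (forall m, (1 <= m <= T)%N -> (1 <= s m <= S)%N) ->
  (forall l m, (1 <= l)%N -> (l < m)%N -> (s l < s m)%N) ->
  X * E <= rho ^+ 4 * K%:R ^+ 4 * Y.+1%:R ->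
  (forall p, P p -> [/\ prime p, ~~ (p %| lam)%N,
     forall j : 'I_Y, (lam ^ j.+1 != 1 %[mod p])%N,
     (energy lam p K)%:R <= E & W < max_expsum R lam s T p]) ->
  (#|P|%:R * W) ^+ 2 <=
  T%:R * (3 * #|P|%:R ^+ 2 * X + 9 * rho ^+ 2 * S%:R * (X ^+ 2 * (1 + ln X))).
Proof.
move=> rho0 W0 K0 S0 n0 nX sS smono num hP.
have X0 : 0 <= X by apply: le_trans nX.
have [t ht] : {t : 'I_n.+1 -> nat & forall p, P p -> is_order lam p (t p) /\ (t p %| p.-1)%N}.
  apply: (@choice _ _ (fun (p : 'I_n.+1) t => P p -> is_order lam p t /\ (t %| p.-1)%N)) => p.
  have [Pp|nP] := boolP (P p); last by exists 0%N.
  have [pp pl _ _ _] := hP _ Pp.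
  by have [t ? ?] := exists_order pp pl; exists t.
have [a ha] : {a : 'I_n.+1 -> int & forall p, P p -> coprimez (a p) p /\
    W < cabs (\sum_(1 <= m < T.+1) fexp R p (a p) lam (s m))}.
  apply: (@choice _ _ (fun (p : 'I_n.+1) a => P p -> coprimez a p /\
    W < cabs (\sum_(1 <= m < T.+1) fexp R p a lam (s m)))) => p.
  have [Pp|nP] := boolP (P p); last by exists 0.
  have [_ _ _ _ h] := hP _ Pp.
  by have [c ?] := lt_max_expsum h; exists c.
have Yt p : P p -> (Y < t p)%N.
  move=> Pp; rewrite ltnNge; apply/negP => tY.
  have [[t0 h] _] := ht _ Pp; have [_ _ hj _ _] := hP _ Pp.
  have tY' : ((t p).-1 < Y)%N by rewrite prednK.
  have /negP := hj (Ordinal tY'); apply; rewrite /= prednK//.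
  by rewrite -[1%N](expn0 lam) h modnn mod0n.
have pX (p : 'I_n.+1) : p%:R <= X.
  by apply: le_trans nX; rewrite ler_nat -ltnS.
have ls := @exp_sums_large_sieve R 'I_n.+1 P (fun p => p) t a lam T S s X rho X0 rho0 S0 sS smono.
apply: (le_trans _ (le_trans (ls _ _) _)).
- rewrite lerXn2r// ?nnegrE ?mulr_ge0// ?sumr_ge0// => [p _|]; first exact: cabs_ge0.
  rewrite mulr_natl -sumr_const; apply: ler_sum => p Pp.
  by apply: ltW; have [] := ha _ Pp.
- move=> p Pp; have [pp _ _ _ _] := hP _ Pp; split => //; first exact: prime_gt0.
    by have [] := ha _ Pp.
  by have [] := ht _ Pp.
- move=> p b c Pp cp; have [pp _ _ hE _] := hP _ Pp.
  by apply: (@dft_fexp_le_rho _ _ _ _ K Y _ X _ E) => //; [exact: prime_gt0|have [] := ht _ Pp|exact: Yt].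
rewrite ler_wpM2l// lerD2l ler_wpM2l ?mulr_ge0 ?exprn_ge0//.
apply: (sum_gcd_orders_le nX n0) => p Pp.
have [pp _ _ _ _] := hP _ Pp; split; first exact: prime_gt1.
by have [] := ht _ Pp.
Qed.

End GoodPrimes.

(** * The number of exceptional primes *)

Lemma leq_card_cover (T : finType) (A B D : pred T) :
  (forall x, A x -> B x || D x) -> (#|A| <= #|B| + #|D|)%N.
Proof.
move=> h; rewrite -(cardID B A) leq_add//; apply/subset_leq_card/fintype.subsetP => x.
  by rewrite !inE => /andP[].
by move=> /andP[nB /h /orP[Bx|//]]; rewrite -[x \in B]/(B x) Bx in nB.
Qed.

(** A small power of X that absorbs logarithms, the o(1) in the growth of the
    sequence and the losses on the exceptional sets. Any positive value up to
    1/924 would do: [good_exceptional_powR] needs 11 eta <= 1/12 - 1/14. *)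
Definition eta (R : realType) : R := 1000^-1.

Section Asymptotics.
Variable R : realType.
Implicit Types (X eps : R).

Lemma powR_add X (a b : R) : 0 < X -> X `^ (a + b) = X `^ a * X `^ b.
Proof. by move=> X0; rewrite powRD// (gt_eqF X0) implybT. Qed.

Lemma powR_exprn X (a : R) (n : nat) : (X `^ a) ^+ n = X `^ (a * n%:R).
Proof. by rewrite powRrM powR_mulrn// powR_ge0. Qed.

(** Markov's inequality for the energy. *)
Lemma card_bad_energy_le (n lam K : nat) (c : R) X : (1 < lam)%N -> (0 < K)%N -> 0 < c ->
  n.+1%:R <= 2 * X -> K%:R ^+ 3 <= 8 * X ->
  #|[pred p : 'I_n.+1 | prime p && ~~ ((energy lam p K)%:R <= K%:R ^+ 2 * c)]|%:R * c
  <= (4 + 8 * lam%:R) * X.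
Proof.
move=> lam1 K0 c0 nX KX; set B := [pred p : 'I_n.+1 | _].
have KR : 0 < K%:R :> R by rewrite ltr0n.
have h : #|B|%:R * (K%:R ^+ 2 * c) <= (\sum_(p < n.+1 | prime p) energy lam p K)%N%:R :> R.
  rewrite natr_sum mulr_natl -sumr_const.
  rewrite [leRHS](bigID (fun p : 'I_n.+1 => ~~ ((energy lam p K)%:R <= K%:R ^+ 2 * c :> R)))/=.
  rewrite -[leLHS]addr0 lerD ?sumr_ge0//.
  by apply: ler_sum => p /andP[_]; rewrite -ltNge => /ltW.
have {}h : #|B|%:R * (K%:R ^+ 2 * c) <= (2 * K ^ 2 * n.+1 + lam * K ^ 5)%N%:R.
  apply: (le_trans h); rewrite ler_nat (leq_trans (sum_energy_le n.+1 K lam1))//.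
  rewrite leq_add2r leq_mul2l.
  by apply/orP; right; rewrite -[leqRHS]card_ord max_card.
have K2 : 0 < K%:R ^+ 2 :> R by rewrite exprn_gt0.
rewrite -(ler_pM2l K2).
have -> : K%:R ^+ 2 * (#|B|%:R * c) = #|B|%:R * (K%:R ^+ 2 * c) by ring.
apply: (le_trans h).
have -> : (2 * K ^ 2 * n.+1 + lam * K ^ 5)%N%:R =
          K%:R ^+ 2 * (2 * n.+1%:R + lam%:R * K%:R ^+ 3) :> R.
  rewrite natrD (natrM _ lam) natrX (natrM _ (2 * K ^ 2)%N) (natrM _ 2%N) natrX.
  by ring.
rewrite ler_wpM2l ?(ltW K2)//.
have -> : (4 + 8 * lam%:R) * X = 2 * (2 * X) + lam%:R * (8 * X) by ring.
by rewrite lerD// ler_wpM2l.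
Qed.

Local Notation eta := (eta R).

Lemma sum_length_itv eps X : 0 < eps -> 3 <= ln X -> 4 <= X ->
  let T := sum_length eps X in
  [/\ T%:R <= X * ln X `^ (2 + eps), X * ln X `^ (2 + eps) <= 2 * T%:R & X <= 2 * T%:R].
Proof.
move=> eps0 L3 X4 T.
have y1 : 1 <= ln X `^ (2 + eps).
  by rewrite -[leLHS](powRr0 (ln X)); apply: ler_powR; lra.
have yX : X <= X * ln X `^ (2 + eps) by apply: ler_peMr => //; lra.
have y0 : 0 <= X * ln X `^ (2 + eps) by lra.
have Ty : T%:R <= X * ln X `^ (2 + eps) by rewrite /T /sum_length truncn_le.
have yT : X * ln X `^ (2 + eps) < T%:R + 1.
  by rewrite natr1; have /andP[] := truncn_itv y0.
split=> //; lra.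
Qed.

(** The main term 3 B^2 X T is absorbed by the left-hand side because T is large
    compared with X. *)
Lemma good_count_bound (B T X w Q : R) : 0 < T -> 0 < X -> 0 < w ->
  4 * X * w ^+ 2 <= T ->
  (B * (T * w^-1)) ^+ 2 <= T * (3 * B ^+ 2 * X + Q) -> B ^+ 2 * X <= Q.
Proof.
move=> T0 X0 w0 TX h.
have w20 : 0 < w ^+ 2 by rewrite exprn_gt0.
have h1 : B ^+ 2 * T <= w ^+ 2 * (3 * B ^+ 2 * X + Q).
  rewrite -(ler_pM2l T0).
  have -> : T * (B ^+ 2 * T) = w ^+ 2 * (B * (T * w^-1)) ^+ 2.
    by field; rewrite gt_eqF.
  by rewrite [leRHS]mulrCA ler_pM2l.
have h2 : B ^+ 2 * (4 * X * w ^+ 2) <= B ^+ 2 * T by rewrite ler_wpM2l ?sqr_ge0.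
rewrite -(ler_pM2l w20); nra.
Qed.

(** T is at least X (ln X)^(2 + eps) / 2 while ln T <= 2 ln X, so the power of
    ln T costs at most (ln X)^eps, and (ln X)^2 >= 9 pays for the constants. *)
Lemma sum_length_dominates eps X : 0 < eps -> 3 <= ln X -> 4 <= X ->
  let T := sum_length eps X in
  T%:R <= X `^ 2 -> 4 * X * (ln T%:R `^ (eps / 5)) ^+ 2 <= T%:R.
Proof.
move=> eps0 L3 X4 T TX; have [_ Tge XT] := sum_length_itv eps0 L3 X4.
rewrite -/T in Tge XT; clearbody T.
have X0 : 0 < X by lra.
have L0 : 0 < ln X by lra.
have T1 : 1 <= T%:R :> R by lra.
have h1 : ln T%:R <= ln X ^+ 2.
  apply: (@le_trans _ _ (2 * ln X)); last by rewrite expr2 ler_wpM2r; lra.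
  by rewrite -ln_powR ler_ln ?posrE ?powR_gt0// (lt_le_trans _ T1).
have h2 : (ln T%:R `^ (eps / 5)) ^+ 2 <= ln X `^ eps.
  rewrite powR_exprn; apply: (@le_trans _ _ ((ln X ^+ 2) `^ (eps / 5 * 2%:R))).
    by apply: ge0_ler_powR; rewrite ?nnegrE ?exprn_ge0 ?ln_ge0 ?(ltW L0)//; lra.
  by rewrite -powR_mulrn ?(ltW L0)// -powRrM; apply: ler_powR; lra.
have h3 : 8 * ln X `^ eps <= ln X `^ (2 + eps).
  rewrite powR_add// powR_mulrn ?(ltW L0)// ler_wpM2r ?powR_ge0//.
  by rewrite (@le_trans _ _ (3 ^+ 2))//; [lra|rewrite lerXn2r ?nnegrE//; lra].
have : X * (8 * (ln T%:R `^ (eps / 5)) ^+ 2) <= X * ln X `^ (2 + eps).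
  by rewrite ler_wpM2l ?(ltW X0)// (le_trans _ h3)// ler_wpM2l.
lra.
Qed.

(** [(1 + eta) (15/14 + eta) <= 15/14 + 3 eta]. *)
Lemma exists_exponent_range X (s : nat -> nat) (nu : nat -> R) (T : nat) :
  1 <= X -> (1 < T)%N -> T%:R <= X `^ (1 + eta) -> admissible nu s -> nu T <= eta ->
  exists S : nat, [/\ (0 < S)%N, (forall m, (1 <= m <= T)%N -> (1 <= s m <= S)%N)
    & S%:R <= X `^ (15 / 14 + 3 * eta)].
Proof.
move=> X1 T1 TX [s1 smono sle] nuT.
exists (Num.truncn (T%:R `^ (15 / 14 + eta) : R)).
have sT : (s T <= Num.truncn (T%:R `^ (15 / 14 + eta) : R))%N.
  rewrite truncn_ge_nat ?powR_ge0//; apply: (le_trans (sle _ (ltnW T1))).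
  by apply: ler_powR; rewrite ?ler1n ?lerD2l// (ltnW T1).
split.
- by rewrite (leq_trans _ sT)// s1// ltnW.
- move=> m /andP[m1]; rewrite s1//= leq_eqVlt => /predU1P[->//|mT].
  by rewrite (leq_trans _ sT)// ltnW// smono.
apply: (@le_trans _ _ (T%:R `^ (15 / 14 + eta))); first by rewrite truncn_le powR_ge0.
apply: (@le_trans _ _ ((X `^ (1 + eta)) `^ (15 / 14 + eta))).
  by apply: ge0_ler_powR; rewrite ?nnegrE ?ler0n ?powR_ge0//; rewrite /eta; lra.
by rewrite -powRrM; apply: ler_powR => //; rewrite /eta; lra.
Qed.

Lemma exists_nat_powR X (c : R) : 1 <= X -> 0 <= c ->
  exists K : nat, [/\ (0 < K)%N, X `^ c <= K%:R & K%:R <= 2 * X `^ c].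
Proof.
move=> X1 c0; exists (Num.truncn (X `^ c)).+1; split => //.
  by have /andP[_ /ltW] := truncn_itv (powR_ge0 X c).
have h1 : (Num.truncn (X `^ c))%:R <= X `^ c by rewrite truncn_le powR_ge0.
have h2 : 1 <= X `^ c by rewrite -[leLHS](powRr0 X); exact: ler_powR.
by rewrite -natr1; lra.
Qed.

(** With rho = X ^ (- 1/24 + eta / 2) the remaining term of the large sieve is
    X ^ (- 1/12 + 15/14 + 2) up to powers of X ^ eta, so that the square of the
    number of primes in P is at most X ^ (2 - 1/84 + 5 eta). *)
Lemma good_exceptional_powR (lam T S K Y n : nat) eps X (s : nat -> nat) (P : pred 'I_n.+1) :
  4 <= X -> (0 < K)%N -> (0 < S)%N -> (0 < n)%N -> (1 < T)%N -> n%:R <= X ->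
  X `^ (1 / 3) <= K%:R -> X `^ (1 / 2 - eta) <= Y.+1%:R ->
  S%:R <= X `^ (15 / 14 + 3 * eta) -> 9 * (1 + ln X) <= X `^ eta ->
  4 * X * (ln T%:R `^ (eps / 5)) ^+ 2 <= T%:R ->
  (forall m, (1 <= m <= T)%N -> (1 <= s m <= S)%N) ->
  (forall l m, (1 <= l)%N -> (l < m)%N -> (s l < s m)%N) ->
  (forall p, P p -> [/\ prime p, ~~ (p %| lam)%N,
     forall j : 'I_Y, (lam ^ j.+1 != 1 %[mod p])%N,
     (energy lam p K)%:R <= K%:R ^+ 2 * X `^ eta
     & 1 * T%:R * ln T%:R `^ (- (eps / 5)) < max_expsum R lam s T p]) ->
  #|P|%:R <= X `^ (1 - 3 * eta).
Proof.
move=> X4 K0 S0 n0 T1 nX KX YX SX L9 wT sS smono hP.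
have X0 : 0 < X by lra.
have X1 : 1 <= X by lra.
have X00 := ltW X0.
have powX (a b : R) : a <= b -> X `^ a <= X `^ b by move=> ab; exact: ler_powR.
pose rho := X `^ (- (1 / 24) + eta / 2).
(* from K >= X ^ (1/3): the exponents are 1 + eta on both sides *)
have num : X * (K%:R ^+ 2 * X `^ eta) <= rho ^+ 4 * K%:R ^+ 4 * Y.+1%:R.
  have -> : X * (K%:R ^+ 2 * X `^ eta) = K%:R ^+ 2 * (X `^ (1 + eta)).
    by rewrite powR_add// powRr1//; ring.
  have -> : rho ^+ 4 * K%:R ^+ 4 * Y.+1%:R = K%:R ^+ 2 * (rho ^+ 4 * K%:R ^+ 2 * Y.+1%:R) by ring.
  rewrite ler_wpM2l ?exprn_ge0//.
  apply: (@le_trans _ _ (rho ^+ 4 * (X `^ (1 / 3)) ^+ 2 * X `^ (1 / 2 - eta))).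
    by rewrite /rho !powR_exprn -!powR_add//; apply: powX; lra.
  rewrite ler_pM ?mulr_ge0 ?exprn_ge0 ?powR_ge0//.
  by rewrite ler_wpM2l ?exprn_ge0 ?powR_ge0// lerXn2r ?nnegrE ?powR_ge0.
pose w : R := ln T%:R `^ (eps / 5).
have w0 : 0 < w by rewrite powR_gt0// ln_gt0// ltr1n.
have T0 : 0 < T%:R :> R by rewrite ltr0n ltnW.
have WE : 1 * T%:R * ln T%:R `^ (- (eps / 5)) = T%:R * w^-1 by rewrite mul1r powRN.
have W0 : 0 <= T%:R * w^-1 by rewrite mulr_ge0 ?invr_ge0 ?(ltW w0).
rewrite WE in hP.
have key := good_exceptional_le (powR_ge0 _ _ : 0 <= rho) W0 K0 S0 n0 nX sS smono num hP.
have := good_count_bound T0 X0 w0 wT key.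
rewrite -[X in _ <= X](_ : rho ^+ 2 * S%:R * X ^+ 2 * (9 * (1 + ln X)) = _); last by ring.
move=> h; rewrite -(ler_pXn2r (n := 2))// ?nnegrE ?powR_ge0//.
rewrite -(ler_pM2r X0) (le_trans h)//.
apply: (@le_trans _ _ (rho ^+ 2 * X `^ (15 / 14 + 3 * eta) * X `^ 2 * X `^ eta)).
  have L0 : 0 <= 9 * (1 + ln X) by rewrite mulr_ge0// addr_ge0// ln_ge0.
  rewrite powR_mulrn//; apply: ler_pM => //; first by rewrite !mulr_ge0 ?exprn_ge0 ?powR_ge0.
  by rewrite ler_wpM2r ?exprn_ge0// ler_wpM2l ?exprn_ge0 ?powR_ge0.
rewrite -[X in _ <= _ * X](powRr1 X00) /rho !powR_exprn -!powR_add//.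
by apply: powX; rewrite /eta; lra.
Qed.

(** An exceptional prime divides lam, or has small order, or has large energy, or
    is counted in [good_exceptional_powR]. *)
Lemma exceptional_count_le (lam : nat) eps X (s : nat -> nat) (nu : nat -> R) :
  (1 < lam)%N -> 0 < eps -> 3 <= ln X -> 4 <= X ->
  ln X `^ (2 + eps) <= X `^ eta ->
  admissible nu s -> nu (sum_length eps X) <= eta ->
  9 * (1 + ln X) <= X `^ eta ->
  5 + 10 * lam%:R <= X `^ (eta / 2) ->
  (exceptional_count lam eps 1 s X)%:R <= X `^ (1 - eta / 2).
Proof.
move=> lam1 eps0 L3 X4 LX adm nuT L9 lamX.
have X0 : 0 < X by lra.
have X1 : 1 <= X by lra.
have X00 := ltW X0.
have eta0 : 0 < eta by rewrite /eta; lra.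
have powX (a b : R) : a <= b -> X `^ a <= X `^ b by move=> ab; exact: ler_powR.
have [Tle _ XT] := sum_length_itv eps0 L3 X4.
have Tdom := sum_length_dominates eps0 L3 X4.
rewrite /exceptional_count count_primesE.
set T := sum_length eps X in nuT Tle XT Tdom *; set n := Num.truncn X.
have nX : n%:R <= X by rewrite truncn_le.
have n0 : (0 < n)%N by rewrite truncn_gt0.
clearbody n T.
have TX : T%:R <= X `^ (1 + eta).
  by rewrite powR_add// powRr1// (le_trans Tle)// ler_wpM2l.
have T1 : (1 < T)%N by rewrite -(ler_nat R); lra.
have {}Tdom := Tdom (le_trans TX (powX _ _ _)).
have {}Tdom : 4 * X * (ln T%:R `^ (eps / 5)) ^+ 2 <= T%:R by apply: Tdom; rewrite /eta; lra.
have [S [S0 sS SX]] := exists_exponent_range X1 T1 TX adm nuT.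
have [K [K0 KX XK]] := exists_nat_powR X1 (ltac:(lra) : 0 <= 1 / 3 :> R).
pose Y := Num.truncn (X `^ (1 / 2 - eta)).
have YX : X `^ (1 / 2 - eta) <= Y.+1%:R.
  by have /andP[_ /ltW] := truncn_itv (powR_ge0 X (1 / 2 - eta)).
have XY : Y%:R <= X `^ (1 / 2 - eta) by rewrite truncn_le powR_ge0.
clearbody Y.
set W := _ * _ * _ `^ _.
pose A0 := [pred p : 'I_n.+1 | prime p && (p %| lam)%N].
pose A1 := [pred p : 'I_n.+1 | prime p && [exists j : 'I_Y, lam ^ j.+1 == 1 %[mod p]]%N].
pose A2 := [pred p : 'I_n.+1 | prime p && ~~ ((energy lam p K)%:R <= K%:R ^+ 2 * X `^ eta)].
pose A3 := [pred p : 'I_n.+1 | [&& prime p, ~~ (p %| lam)%N,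
  ~~ [exists j : 'I_Y, lam ^ j.+1 == 1 %[mod p]]%N,
  (energy lam p K)%:R <= K%:R ^+ 2 * X `^ eta & ~~ (max_expsum R lam s T p <= W)]].
have cover : (#|[pred p : 'I_n.+1 | prime p && ~~ (max_expsum R lam s T p <= W)%R]|
    <= #|A0| + (#|A1| + (#|A2| + #|A3|)))%N.
  apply: (leq_trans (leq_card_cover (B := A0) (D := [predU A1 & [predU A2 & A3]]) _)).
    move=> p /= /andP[pp pW]; rewrite !inE /= pp pW /=.
    by case: (p %| lam)%N => //=; case: [exists _, _] => //=; case: (_ <= _ * _)%R.
  rewrite leq_add2l (leq_trans (leq_card_cover (B := A1) (D := [predU A2 & A3]) _))//.
  by rewrite leq_add2l leq_card_cover.
have XE1 : 1 <= X `^ (1 - eta) by rewrite -[leLHS](powRr0 X); apply: powX; rewrite /eta; lra.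
have c0 : #|A0|%:R <= lam%:R * X `^ (1 - eta).
  apply: (@le_trans _ _ lam%:R); last by rewrite ler_peMr.
  by rewrite ler_nat card_prime_divisors_le// ltnW// ltn_expl.
have c1 : #|A1|%:R <= lam%:R * X `^ (1 - eta).
  apply: (@le_trans _ _ (lam * Y ^ 2)%N%:R); first by rewrite ler_nat card_small_order_le.
  rewrite natrM natrX ler_wpM2l//.
  apply: (@le_trans _ _ ((X `^ (1 / 2 - eta)) ^+ 2)).
    by rewrite lerXn2r// nnegrE ?powR_ge0.
  by rewrite powR_exprn; apply: powX; rewrite /eta; lra.
have c2 : #|A2|%:R <= (4 + 8 * lam%:R) * X `^ (1 - eta).
  rewrite -(ler_pM2r (powR_gt0 eta X0)) -mulrA -powR_add// subrK powRr1//.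
  apply: card_bad_energy_le; rewrite ?powR_gt0//; first by rewrite -natr1; lra.
  apply: (@le_trans _ _ ((2 * X `^ (1 / 3)) ^+ 3)).
    by rewrite lerXn2r// nnegrE ?mulr_ge0 ?powR_ge0.
  rewrite exprMn powR_exprn (_ : 1 / 3 * 3%:R = 1); last by field.
  by rewrite powRr1//; lra.
have c3 : #|A3|%:R <= X `^ (1 - eta).
  have [_ smono _] := adm.
  apply: (@le_trans _ _ (X `^ (1 - 3 * eta))).
    apply: (@good_exceptional_powR lam T S K Y n eps X s A3) => //.
    by move=> p /and5P[pp pl /existsPn pj pE]; rewrite -ltNge.
  by apply: powX; lra.
apply: (le_trans (_ : _ <= (#|A0| + (#|A1| + (#|A2| + #|A3|)))%N%:R)); first by rewrite ler_nat.
rewrite !natrD; apply: (@le_trans _ _ ((5 + 10 * lam%:R) * X `^ (1 - eta))).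
  have -> : (5 + 10 * lam%:R) * X `^ (1 - eta) = lam%:R * X `^ (1 - eta) +
    (lam%:R * X `^ (1 - eta) + ((4 + 8 * lam%:R) * X `^ (1 - eta) + X `^ (1 - eta))) by ring.
  by rewrite !lerD.
have -> : 1 - eta / 2 = eta / 2 + (1 - eta) by field.
by rewrite [leRHS]powR_add// ler_wpM2r ?powR_ge0.
Qed.

End Asymptotics.

(** * Asymptotics *)

Section Near.
Variable R : realType.

Lemma near_const_le_powR (A c : R) : 0 < c -> \forall X \near +oo, A <= X `^ c.
Proof.
move=> c0.
apply: filterS (nbhs_pinfty_ge (num_real ((`|A| + 1) `^ c^-1))) => X hX.
have A1 : 0 <= `|A| + 1 by rewrite addr_ge0.
apply: (@le_trans _ _ (`|A| + 1)); first by rewrite (le_trans (ler_norm _))// lerDl.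
have <- : ((`|A| + 1) `^ c^-1) `^ c = `|A| + 1.
  by rewrite -powRrM mulVf ?(lt0r_neq0 c0)// powRr1.
apply: ge0_ler_powR => //; first exact: ltW.
  by rewrite nnegrE powR_ge0.
by rewrite nnegrE (le_trans _ hX)// powR_ge0.
Qed.

(** From ln y <= y at y = X ^ c' with a small exponent c'. *)
Lemma near_ln_powR_le_powR (b c : R) : 0 <= b -> 0 < c ->
  \forall X \near +oo, ln X `^ b <= X `^ c.
Proof.
move=> b0 c0; pose c' := c / (2 * (b + 1)).
have b1 : 0 < 2 * (b + 1) by lra.
have c'0 : 0 < c' by rewrite divr_gt0.
apply: filterS2 (nbhs_pinfty_ge (num_real (1 : R))) (near_const_le_powR c'^-1 c'0) => X X1 hX.
have X0 : 0 < X by lra.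
have h1 : c' * ln X <= X `^ c'.
  by rewrite -ln_powR (le_trans (ln_le_sub1 (powR_gt0 _ X0)))// gerBl.
have h2 : ln X <= X `^ (c' + c').
  rewrite powR_add// -(ler_pM2l c'0) (le_trans h1)// mulrA ler_peMl ?powR_ge0//.
  by rewrite -(mulfV (lt0r_neq0 c'0)) ler_pM2l.
apply: (@le_trans _ _ ((X `^ (c' + c')) `^ b)).
  by apply: ge0_ler_powR; rewrite ?nnegrE ?powR_ge0 ?ln_ge0.
rewrite -powRrM; apply: ler_powR => //.
rewrite (_ : (c' + c') * b = c * (b / (b + 1))); last by rewrite /c'; field; lra.
by rewrite ler_piMr ?(ltW c0)// ler_pdivrMr ?mul1r ?lerDl//; lra.
Qed.

End Near.

Theorem corollary2 (R : realType) (lam : nat) (eps : R) (nu : nat -> R)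
    (hlam : (2 <= lam)%N) (heps : 0 < eps) (hnu : nu n @[n --> \oo] --> 0) :
  exists2 C : R, 0 < C &
    forall s : R -> nat -> nat,
      (\forall X \near +oo, admissible nu (s X)) ->
      (fun X : R => (exceptional_count lam eps C (s X) X)%:R : R^o)
        =o_ (pinfty_filter R) (fun X : R => (prime_pi X)%:R : R^o).
Proof.
exists 1 => // s hs; apply/eqoP => e e0.
have eta0 : 0 < eta R by rewrite /eta invr_gt0 ltr0n.
have [N _ hN] : \forall n \near \oo, nu n <= eta R by exact: (cvgr_le _ hnu).
near=> X.
rewrite /= !normr_nat.
have X4 : 4 <= X by near: X; apply: nbhs_pinfty_ge; rewrite num_real.
have X0 : 0 < X by lra.
have XN : N%:R * 2 <= X by near: X; apply: nbhs_pinfty_ge; rewrite num_real.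
have L3 : 3 <= ln X.
  have e3 : expR 3 <= X by near: X; apply: nbhs_pinfty_ge; rewrite num_real.
  by rewrite -[leLHS]expRK ler_ln ?posrE ?expR_gt0.
have LX : ln X `^ (2 + eps) <= X `^ eta R by near: X; apply: near_ln_powR_le_powR => //; lra.
have L4 : ln X `^ 1 <= X `^ (eta R / 4) by near: X; apply: near_ln_powR_le_powR => //; lra.
have A18 : 18 <= X `^ (eta R / 4) by near: X; apply: near_const_le_powR; lra.
have A8 : 8 / e <= X `^ (eta R / 4) by near: X; apply: near_const_le_powR; lra.
have Alam : 5 + 10 * lam%:R <= X `^ (eta R / 2) by near: X; apply: near_const_le_powR; lra.
have adm : admissible nu (s X) by near: X.
have [_ _ XT] := sum_length_itv heps L3 X4.
have nuT : nu (sum_length eps X) <= eta R.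
  apply: hN => /=; rewrite -(ler_nat R); lra.
rewrite powRr1 in L4; last lra.
have L9 : 9 * (1 + ln X) <= X `^ eta R.
  apply: (@le_trans _ _ (X `^ (eta R / 4) * X `^ (eta R / 4))).
    apply: (@le_trans _ _ (18 * ln X)); first lra.
    by apply: ler_pM => //; lra.
  by rewrite -powR_add//; apply: ler_powR; lra.
have := exceptional_count_le hlam heps L3 X4 LX adm nuT L9 Alam.
move=> /le_trans; apply.
have L0 : 0 < ln X by lra.
rewrite -(ler_pM2l L0) -(ler_pM2l (_ : 0 < 8 / e)); last by rewrite divr_gt0.
have -> : 8 / e * (ln X * (e * (prime_pi X)%:R)) = 8 * ((prime_pi X)%:R * ln X).
  by field; rewrite gt_eqF.
apply: (@le_trans _ _ X); last by have := prime_pi_ge X4; lra.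
rewrite mulrA.
apply: (@le_trans _ _ (X `^ (eta R / 4) * X `^ (eta R / 4) * X `^ (1 - eta R / 2))).
  rewrite ler_wpM2r ?powR_ge0//; apply: ler_pM => //; last lra.
  by rewrite divr_ge0// ltW.
rewrite -!powR_add// [Z in _ `^ Z](_ : _ = 1); last by field.
by rewrite powRr1// ltW.
Unshelve. all: by end_near.
Qed.
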